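(* Let $T$ and $\bar T$ define root metrics $F=T^{1/m'}$ and $\bar F=\bar T^{1/m}$ on $M$ of orders $m'$ and $m$ respectively, with $m'<m$, related by $\bar T=\alpha(x,y)\,T$ (so that $\alpha$ is homogeneous of degree $m-m'>0$ in $y$). Then $(M,F)$ and $(M,\bar F)$ are projectively related if and only if $$\alpha_{;i}-\alpha_{;r\cdot i}\,y^r=\frac1m\,\frac{T_i}{T}\,\alpha_{;0}+\frac{1-m}{m}\,\frac{\alpha_i}{\alpha}\,\alpha_{;0},\qquad i=1,\dots,n,$$ where $;$ denotes the covariant derivative associated with the canonical nonlinear connection of $F$.
   Context: Let $M$ be a smooth $n$-dimensional manifold with induced coordinates $(x^i,y^i)$ on $TM$. A $k$-th root metric (root metric of order $k\ge2$) is $F=\sqrt[k]{T}$ with $T=a_{i_1\dots i_k}(x)y^{i_1}\cdots y^{i_k}$, $a_{i_1\dots i_k}$ totally symmetric, such that $g_{ij}=\frac12\frac{\partial^2F^2}{\partial y^i\partial y^j}$ is nondegenerate on $TM\setminus\{0\}$ (at the points where $F$ is defined and smooth). Let $G^i$ be the canonical spray coefficients of $F$ (geodesics $\ddot x^i+2G^i(x,\dot x)=0$) and $N^i_{\ j}=\partial G^i/\partial y^j$ its canonical nonlinear connection. For a function $f(x,y)$: $f_{;i}=\frac{\partial f}{\partial x^i}-N^r_{\ i}\frac{\partial f}{\partial y^r}$, $f_{;r\cdot i}=\frac{\partial}{\partial y^i}(f_{;r})$, $f_{;0}=f_{;r}y^r$; also $T_i=\partial T/\partial y^i$, $\alpha_i=\partial\alpha/\partial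 y^i$. The equality is understood where $T\neq0$ and $\alpha\ne0$. Two Finsler metrics on $M$ are projectively related if every geodesic of either one coincides, as a set of points, with a geodesic of the other.
   Formalization: ''Projectively related'' compares only geodesics whose velocities stay where both F and F̄ are defined with T and T̄ nonzero, and the equation is imposed there; without this it fails, e.g. Euclidean plane with T̄ = Re(y¹+iy²)³, where some lines have T̄ = 0. *)

(* Defs.v *)
From HB Require Import structures.
From mathcomp Require Import all_boot all_order all_algebra all_fingroup.
From mathcomp Require Import all_classical all_reals all_analysis.

Set Implicit Arguments.
Unset Strict Implicit.
Unset Printing Implicit Defensive.

Import Order.TTheory GRing.Theory Num.Theory.
Import numFieldNormedType.Exports.

Local Open Scope classical_set_scope.
Local Open Scope ring_scope.

Section Smoothness.
Variables (R : realType) (n : nat).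

Definition basis_vec (i : 'I_n) : 'rV[R]_n := delta_mx 0 i.

Definition iter_partial (s : seq 'I_n) (f : 'rV[R]_n -> R) : 'rV[R]_n -> R :=
  foldr (fun i g => 'D_(basis_vec i) g) f s.

(* C^oo on the open set U: every iterated partial derivative is Frechet
   differentiable (hence continuous) at every point of U. *)
Definition smooth_on (U : set 'rV[R]_n) (f : 'rV[R]_n -> R) : Prop :=
  forall (s : seq 'I_n) (x : 'rV[R]_n), U x -> differentiable (iter_partial s f) x.

End Smoothness.

Section Manifolds.
Variables (R : realType) (n : nat).

(* [chart_map] and [chart_inv] are total functions, meaningful only on
   [chart_dom] and on its image respectively. *)
Record chart (M : topologicalType) := Chart {
  chart_dom : set M;
  chart_map : M -> 'rV[R]_n;
  chart_inv : 'rV[R]_n -> M;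
  chart_dom_open : open chart_dom;
  chart_img_open : open (chart_map @` chart_dom);
  chart_mapK : forall p, chart_dom p -> chart_inv (chart_map p) = p;
  chart_map_cont : forall p, chart_dom p -> {for p, continuous chart_map};
  chart_inv_cont : forall x, (chart_map @` chart_dom) x ->
    {for x, continuous chart_inv}
}.

Definition chart_img (M : topologicalType) (c : chart M) : set 'rV[R]_n :=
  chart_map c @` chart_dom c.

Definition chart_overlap (M : topologicalType) (c d : chart M) : set 'rV[R]_n :=
  chart_map c @` (chart_dom c `&` chart_dom d).

Definition transition (M : topologicalType) (c d : chart M)
    (x : 'rV[R]_n) : 'rV[R]_n :=
  chart_map d (chart_inv c x).

Record manifold := Manifold {
  carrier :> topologicalType;
  carrier_hausdorff : hausdorff_space carrier;
  carrier_second_countable : @second_countable carrier;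
  chart_index : Type;
  atlas : chart_index -> chart carrier;
  atlas_cover : forall p : carrier, exists c, chart_dom (atlas c) p;
  atlas_smooth : forall (c d : chart_index) (j : 'I_n),
    smooth_on (chart_overlap (atlas c) (atlas d))
      (fun x => transition (atlas c) (atlas d) x 0 j)
}.

End Manifolds.

Section Root.
Variable R : realType.

(* The real k-th root: the odd root of a negative number is negative. For k even
   and t < 0 the value is meaningless. *)
Definition kroot (k : nat) (t : R) : R := Num.sg t * (`|t| `^ (k%:R^-1)).

(* The t <> 0 at which the real k-th root is defined. *)
Definition root_regular (k : nat) (t : R) : Prop :=
  if odd k then t != 0 else 0 < t.

End Root.

(* Functions of the induced coordinates (x, y) on TM. *)
Section Coordinates.
Variables (R : realType) (n : nat).

Implicit Types (f T : 'rV[R]_n * 'rV[R]_n -> R) (p : 'rV[R]_n * 'rV[R]_n).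

Definition ddx (i : 'I_n) f p : R := 'D_((basis_vec R i, 0)) f p.
Definition ddy (i : 'I_n) f p : R := 'D_((0, basis_vec R i)) f p.

Section Spray.
Variables (k : nat) (T : 'rV[R]_n * 'rV[R]_n -> R).

Definition Fsq p : R := kroot k (T p) ^+ 2.

Definition fund_tensor p : 'M[R]_n :=
  \matrix_(i, j) (2^-1 * ddy i (ddy j Fsq) p).

(* G^i = 1/4 g^{ij} ([F^2]_{x^l y^j} y^l - [F^2]_{x^j}), i.e. the
   Euler-Lagrange equations of F^2 / 2 solved for the acceleration - 2 G^i. *)
Definition spray (i : 'I_n) p : R :=
  4^-1 * \sum_(j < n) invmx (fund_tensor p) i j *
    (\sum_(l < n) ddx l (ddy j Fsq) p * p.2 0 l - ddx j Fsq p).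

Definition nonlin_conn (i j : 'I_n) p : R := ddy j (spray i) p.

(* f_{;i} *)
Definition hderiv (i : 'I_n) f p : R :=
  ddx i f p - \sum_(r < n) nonlin_conn r i p * ddy r f p.

(* f_{;0} *)
Definition hderiv0 f p : R := \sum_(r < n) hderiv r f p * p.2 0 r.

End Spray.

End Coordinates.

Section RootMetrics.
Variables (R : realType) (n : nat) (M : manifold R n).

Local Notation I := (chart_index M).
Local Notation V := 'rV[R]_n.

(* A function on TM minus the zero section, given by its expressions in the
   induced coordinates; y transforms by the differential of the transition. *)
Record TM_function := TMFunction {
  TMf :> I -> V * V -> R;
  TMf_compat : forall (c d : I) (x y : V),
    chart_overlap (atlas c) (atlas d) x -> y != 0 ->
    TMf c (x, y) =
    TMf d (transition (atlas c) (atlas d) x,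
           'D_y (transition (atlas c) (atlas d)) x)
}.

(* Smooth totally symmetric covariant k-tensor field a_{i_1 ... i_k}; the
   multi-index (i_1, ..., i_k) is a finite function. *)
Record sym_tensor (k : nat) := SymTensor {
  coef : I -> V -> {ffun 'I_k -> 'I_n} -> R;
  coef_smooth : forall (c : I) (J : {ffun 'I_k -> 'I_n}),
    smooth_on (chart_img (atlas c)) (fun x => coef c x J);
  coef_sym : forall (c : I) (x : V) (J : {ffun 'I_k -> 'I_n}) (s : 'S_k),
    chart_img (atlas c) x -> coef c x [ffun l => J (s l)] = coef c x J;
  coef_compat : forall (c d : I) (x : V) (J : {ffun 'I_k -> 'I_n}),
    chart_overlap (atlas c) (atlas d) x ->
    coef c x J =
    \sum_(L : {ffun 'I_k -> 'I_n})
      coef d (transition (atlas c) (atlas d) x) L *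
      \prod_(l < k)
        ('D_(basis_vec R (J l)) (transition (atlas c) (atlas d)) x) 0 (L l)
}.

(* T = a_{i_1 ... i_k}(x) y^{i_1} ... y^{i_k} *)
Definition root_form (k : nat) (a : sym_tensor k) (c : I) (p : V * V) : R :=
  \sum_(J : {ffun 'I_k -> 'I_n}) coef a c p.1 J * \prod_(l < k) p.2 0 (J l).

(* The points of TM minus the zero section where F is defined and T <> 0. *)
Definition regular (k : nat) (a : sym_tensor k) (c : I) : set (V * V) :=
  [set p | [/\ chart_img (atlas c) p.1, p.2 != 0 & root_regular k (root_form a c p)]].

Definition root_metric (k : nat) (a : sym_tensor k) : Prop :=
  (2 <= k)%N /\
  forall (c : I) (p : V * V), regular a c p ->
    fund_tensor k (root_form a c) p \in unitmx.

(* An (affinely parametrized) geodesic of F, defined on a nonempty open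
   interval J, whose velocity stays in the region D. *)
Definition geodesic (k : nat) (a : sym_tensor k) (D : I -> set (V * V))
    (J : set R) (gamma : R -> M) : Prop :=
  [/\ open J, is_interval J, J !=set0 &
    forall t : R, J t -> {for t, continuous gamma} /\
      forall c : I, chart_dom (atlas c) (gamma t) ->
        let x := chart_map (atlas c) \o gamma in
        [/\ derivable x t 1, derivable (derive1 x) t 1,
            D c (x t, derive1 x t) &
            forall i : 'I_n,
              (derive1 (derive1 x) t) 0 i +
              2 * spray k (root_form a c) i (x t, derive1 x t) = 0]].

(* The region where both root metrics are defined, with T <> 0 <> Tbar. *)
Definition common_regular (k l : nat) (a : sym_tensor k) (b : sym_tensor l)
    (c : I) : set (V * V) :=
  regular a c `&` regular b c.

(* "Every geodesic" refers to the geodesics lying in the region where both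
   metrics are defined: outside it the other metric has no geodesics to
   compare with. *)
Definition projectively_related (k l : nat)
    (a : sym_tensor k) (b : sym_tensor l) : Prop :=
  let D := common_regular a b in
  (forall (J : set R) (gamma : R -> M), geodesic a D J gamma ->
     exists (J' : set R) (gamma' : R -> M),
       geodesic b D J' gamma' /\ gamma @` J = gamma' @` J') /\
  (forall (J : set R) (gamma : R -> M), geodesic b D J gamma ->
     exists (J' : set R) (gamma' : R -> M),
       geodesic a D J' gamma' /\ gamma @` J = gamma' @` J').

End RootMetrics.

(* Main.v *)
Require Import Defs.
From mathcomp Require Import all_boot all_order all_algebra.
From mathcomp Require Import all_classical all_reals all_analysis.
From mathcomp Require Import ring lra.

(** The Euler-Lagrange expression of a function f along the spray G of F is
    E(f)_i = f_{;i} - f_{;r.i} y^r, and T satisfies E(T) = 0 and T_{;0} = 0. Since E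
    obeys a Leibniz rule, substituting \bar T = alpha T turns the stated equation
    into E(\bar F^2)_i = - (\bar F^2)_i (\bar F^2)_{;0} / (2 \bar F^2), and inverting
    the fundamental tensor of \bar F shows that this means \bar G^i = G^i + P y^i with
    P = (\bar F^2)_{;0} / (4 \bar F^2).

    If the sprays differ by P y^i, a geodesic of either metric becomes one of the
    other when it is parametrized by the arclength of the latter. Conversely, through
    every point (x, y) there is a geodesic of F (Picard iteration; by invariance of
    the Euler-Lagrange equations it is a geodesic in every chart), and a geodesic of
    \bar F with the same image is locally a C^2 reparametrization of it; comparing
    accelerations at (x, y) gives \bar G^i = G^i + P y^i. *)

Set Implicit Arguments.
Unset Strict Implicit.
Unset Printing Implicit Defensive.

Import Order.TTheory GRing.Theory Num.Theory.
Import numFieldNormedType.Exports.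

Local Open Scope classical_set_scope.
Local Open Scope ring_scope.

(** * Differential calculus *)

(** Everything is computed with [Fsq] rather than with the root: where T is nonzero, F^2 =
    (T^2)^(1/k) whatever the sign of T and the parity of k, and T d(F^2) = (2/k) F^2 dT. This
    relation carries E and the operation ;0 from F^2 to T and from \bar T to \bar F^2 without
    expanding second derivatives of powers. Contraction with y^i and homogeneity of degree 2 force
    the value of P, so a factor extracted from geodesics at a single point, with no regularity in
    (x, y), is already the one hidden in the equation. The obstacle in the converse is that
    projective relatedness compares images only: the second geodesic may run backwards and comes
    with no smooth change of parameter. Hence homogeneity is stated for negative scalars too, and
    the change of parameter is recovered from one coordinate. In the other direction, \bar F
    satisfies d\bar F/dt = 2 P \bar F along a geodesic of F, which is exactly what makes the
    arclength parameter absorb the term P y^i. *)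

Section NearDifferentiable.
Context {R : realType} {V W : normedModType R}.

(** The difference [g - f] vanishes near [a], so its remainder against the zero differential is
    eventually zero. *)
Lemma near_eq_differentiable (f g : V -> W) (a : V) :
  (\near a, f a = g a) -> differentiable f a -> differentiable g a.
Proof.
move=> fg df.
pose h : V -> W := g - f.
have hE : g = f + h by rewrite /h addrC subrK.
suff dh : differentiable h a by rewrite hE; apply: differentiableD.
have fg0 : \forall z \near (0 : V), f (z + a) = g (z + a).
  by move: fg; rewrite (near_shift 0 a) subr0.
have ho : h \o shift a = cst (h a) + (\0 : {linear V -> W}) +o_ 0 id.
  apply/eqaddoP => e e0; near=> z.
  rewrite /h /= !fctE /= (nbhs_singleton fg) subrr.
  have -> : f (z + a) = g (z + a) by near: z.
  by rewrite !subrr addr0 subrr normr0 mulr_ge0 // ltW.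
have dh0 : 'd h a = (\0 : {linear V -> W}) :> (V -> W).
  by apply: diff_unique => //; exact: (@cst_continuous V W 0).
by apply/diff_locallyP; rewrite dh0; split => //; exact: (@cst_continuous V W 0).
Unshelve. all: by end_near. Qed.

Lemma derive_lineE (f : V -> W) (q v : V) :
  'D_v f q = 'D_1 (fun h : R => f (h *: v + q)) 0.
Proof.
rewrite /derive; set d := (fun _ => _); set d' := (fun _ => _).
suff -> : d = d' by [].
by apply/funext => h; rewrite /d /d' /= addr0 scale0r add0r [_%:A]mulr1.
Qed.

End NearDifferentiable.

Section DirectionalChain.
Context {R : realType} {V W : normedModType R}.

(** The inner map only has a derivative along [v]. Restricted to the line through [q] it becomes a
    function of one real variable, where derivability is differentiability and the usual chain rule
    applies. *)
Lemma is_derive_comp {U : normedModType R} (f : V -> W) (g : U -> V)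
    (q v : U) (dg : V) :
  differentiable f (g q) -> is_derive q v g dg ->
  is_derive q v (f \o g) ('d f (g q) dg).
Proof.
move=> df [gd <-].
have dl : differentiable (fun h : R => g (h *: v + q)) 0.
  by apply/derivable1_diffP; apply/(derivable1P g q v).1.
have E0 : g (0 *: v + q) = g q by rewrite scale0r add0r.
have df' : differentiable f (g (0 *: v + q)) by rewrite E0.
have dc := differentiable_comp dl df'.
split; first by apply/(derivable1P (f \o g) q v).2/(derivable1_diffP _ (0 : R)).2.
rewrite derive_lineE (derive_lineE g).
rewrite !deriveE //.
by rewrite (diff_comp dl df') /= E0.
Qed.

Lemma is_derive_line (f : V -> W) (u c : V) (s : R) (l : W) :
  is_derive (s *: u + c) u f l ->
  is_derive s 1 (fun s : R => f (s *: u + c)) l.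
Proof.
have E : (fun h : R => h^-1 *: (f (h *: u + (s *: u + c)) - f (s *: u + c))) =
    (fun h : R => h^-1 *: (((fun s : R => f (s *: u + c)) \o shift s) (h *: 1) -
       f (s *: u + c))).
  by apply/funext => h /=; rewrite [_%:A]mulr1 scalerDl addrA.
move=> [fd <-]; split; first by rewrite /derivable -E.
by rewrite /derive -E.
Qed.

End DirectionalChain.

Lemma mean_value {R : realType} (g dg : R -> R) (a b : R) : a <= b ->
  (forall s, a <= s <= b -> is_derive s 1 g (dg s)) ->
  exists2 c, a <= c <= b & g b - g a = dg c * (b - a).
Proof.
move=> ab gd.
have [c cab E] : exists2 c, c \in `[a, b] & g b - g a = dg c * (b - a).
  apply: MVT_segment => //.
    by move=> x; rewrite in_itv /= => /andP[x0 xh]; apply: gd; rewrite !ltW.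
  apply: derivable_within_continuous => x; rewrite in_itv /= => xh.
  by case: (gd x xh).
by exists c => //; rewrite in_itv in cab.
Qed.

(** * Symmetry of second derivatives *)

Section Schwarz.
Context {R : realType} {V : normedModType R}.

(** The mean value theorem is used twice: along [u] for the difference of [f] on two parallel
    segments, then along [v] for the increment of ['D_u f] that results. *)
Lemma second_difference_mvt (f : V -> R) (u v p : V) (h : R) :
  0 < h ->
  (forall s t, 0 <= s <= h -> 0 <= t <= h ->
     differentiable f (s *: u + t *: v + p)) ->
  (forall s t, 0 <= s <= h -> 0 <= t <= h ->
     differentiable ('D_u f) (s *: u + t *: v + p)) ->
  exists s t, [/\ 0 <= s <= h, 0 <= t <= h &
    f (h *: u + h *: v + p) - f (h *: u + p) - f (h *: v + p) + f p
    = h * (h * 'D_v ('D_u f) (s *: u + t *: v + p))].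
Proof.
move=> h0 fd fud.
have hh : 0 <= h <= h by rewrite lexx ltW.
have h00 : 0 <= (0 : R) <= h by rewrite lexx ltW.
pose g s := f (s *: u + (h *: v + p)) - f (s *: u + p).
have gd s : 0 <= s <= h ->
    is_derive s 1 g ('D_u f (s *: u + (h *: v + p)) - 'D_u f (s *: u + p)).
  move=> sh; apply: is_deriveB.
    apply: (is_derive_line (f := f) (u := u)).
    by apply/derivableP/diff_derivable; rewrite addrA; apply: fd.
  apply: (is_derive_line (f := f) (u := u)); apply/derivableP/diff_derivable.
  by have := fd s 0 sh h00; rewrite scale0r addr0.
have [s sh gE] := mean_value (ltW h0) gd.
pose k t := 'D_u f (t *: v + (s *: u + p)).
have kd t : 0 <= t <= h ->
    is_derive t 1 k ('D_v ('D_u f) (t *: v + (s *: u + p))).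
  move=> th; apply: (is_derive_line (f := 'D_u f) (u := v)).
  by apply/derivableP/diff_derivable; rewrite addrCA addrA; apply: fud.
have [t th kE] := mean_value (ltW h0) kd.
exists s, t; split => //.
move: gE kE; rewrite /g /k !scale0r !add0r !subr0 (addrCA (h *: v)).
rewrite (addrCA (t *: v)) !addrA => gE kE.
rewrite kE in gE.
rewrite (mulrC h) [h * _]mulrC -gE opprB.
by rewrite addrAC addrA [RHS]addrAC.
Qed.

(** In [derive_commute] the two mixed derivatives are only known to agree at two different points
    close to [p]; continuity brings both to [p]. *)
Lemma continuous_eq_close (A B : V -> R) (p : V) :
  {for p, continuous A} -> {for p, continuous B} ->
  (forall r, 0 < r -> exists q q', [/\ `|p - q| < r, `|p - q'| < r & A q = B q']) ->
  A p = B p.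
Proof.
move=> cA cB AB; apply/eqP; rewrite -subr_eq0 -normr_le0.
apply/ler_addgt0Pr => e e0; rewrite add0r.
have e20 : 0 < e / 2 by rewrite divr_gt0.
have : \forall q \near p, `|A p - A q| < e / 2.
  by move/cvgrPdist_lt : cA; apply.
move/nbhs_normP => [r1 /= r10 H1].
have : \forall q \near p, `|B p - B q| < e / 2.
  by move/cvgrPdist_lt : cB; apply.
move/nbhs_normP => [r2 /= r20 H2].
have r0 : 0 < Order.min r1 r2 by rewrite lt_min r10.
have [q [q' [pq pq' E]]] := AB _ r0.
rewrite lt_min in pq; rewrite lt_min in pq'.
have [/andP[pq1 _] /andP[_ pq2]] := (pq, pq').
have -> : A p - B p = (A p - A q) - (B p - B q') by rewrite E; ring.
rewrite (le_trans (ler_normB _ _)) // [e]splitr lerD // ltW //.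
  exact: H1.
exact: H2.
Qed.

(** The second difference is symmetric in [u] and [v]; evaluated in both orders it equals [h^2]
    times either mixed derivative, each at its own nearby point. *)
Lemma derive_commute (D : set V) (f : V -> R) (u v p : V) :
  open D -> D p ->
  (forall q, D q -> differentiable f q) ->
  (forall q, D q -> differentiable ('D_u f) q) ->
  (forall q, D q -> differentiable ('D_v f) q) ->
  {for p, continuous ('D_v ('D_u f))} ->
  {for p, continuous ('D_u ('D_v f))} ->
  'D_v ('D_u f) p = 'D_u ('D_v f) p.
Proof.
move=> oD Dp fd fud fvd cuv cvu.
apply: (continuous_eq_close cuv cvu) => {cuv cvu} r0 r0_gt0.
have : nbhs p D by exact: open_nbhs_nbhs.
move/nbhs_normP => [r1 /= r10 HD].
pose r := Order.min r0 r1.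
have r_gt0 : 0 < r by rewrite lt_min r0_gt0.
(* With [h = r / N] the whole parallelogram lies within distance [r] of [p]; the summand 1 keeps [N]
   positive when both directions vanish. *)
pose N := `|u| + `|v| + 1.
have N0 : 0 < N by rewrite ltr_wpDl // addr_ge0.
pose h := r / N.
have h0 : 0 < h by rewrite divr_gt0.
have near_p s t : 0 <= s <= h -> 0 <= t <= h -> `|p - (s *: u + t *: v + p)| < r.
  move=> /andP[s0 sh] /andP[t0 th].
  rewrite opprD addrCA subrr addr0 normrN.
  rewrite (le_lt_trans (ler_normD _ _)) // !normrZ !ger0_norm //.
  have -> : r = h * N by rewrite /h divfK // gt_eqF.
  apply: (@le_lt_trans _ _ (h * `|u| + h * `|v|)).
    by rewrite lerD // ler_wpM2r.
  by rewrite -mulrDr ltr_pM2l // /N ltrDl.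
have near_p' s t : 0 <= s <= h -> 0 <= t <= h ->
    `|p - (s *: v + t *: u + p)| < r.
  by move=> ? ?; rewrite (addrC (s *: v)); apply: near_p.
have inD q : `|p - q| < r -> D q.
  by rewrite lt_min => /andP[_ ?]; apply: HD.
have [s [t [sh th E1]]] : exists s t, [/\ 0 <= s <= h, 0 <= t <= h &
    f (h *: u + h *: v + p) - f (h *: u + p) - f (h *: v + p) + f p
    = h * (h * 'D_v ('D_u f) (s *: u + t *: v + p))].
  apply: second_difference_mvt => // s t hs ht.
    by apply: fd; apply: inD; apply: near_p.
  by apply: fud; apply: inD; apply: near_p.
have [s' [t' [sh' th' E2]]] : exists s t, [/\ 0 <= s <= h, 0 <= t <= h &
    f (h *: v + h *: u + p) - f (h *: v + p) - f (h *: u + p) + f p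
    = h * (h * 'D_u ('D_v f) (s *: v + t *: u + p))].
  apply: second_difference_mvt => // s' t' hs ht.
    by apply: fd; apply: inD; apply: near_p'.
  by apply: fvd; apply: inD; apply: near_p'.
exists (s *: u + t *: v + p), (s' *: v + t' *: u + p); split.
- by have := near_p _ _ sh th; rewrite lt_min => /andP[].
- by have := near_p' _ _ sh' th'; rewrite lt_min => /andP[].
move: E1 E2; rewrite (addrC (h *: v) (h *: u)).
set A := 'D_v _ _; set B := 'D_u _ _; move: A B => A B E1 E2.
have hn0 : h != 0 by rewrite gt_eqF.
apply: (mulfI hn0); apply: (mulfI hn0); rewrite -E1 -E2.
by ring.
Qed.

End Schwarz.

Lemma is_derive_scalar_comp {R : realType} {W : normedModType R} (f : W -> R)
    (psi : R -> R) (q v : W) (df dpsi : R) :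
  is_derive (f q) 1 psi dpsi -> is_derive q v f df ->
  is_derive q v (psi \o f) (dpsi * df).
Proof.
move=> [pd pE] fd.
have pd' : differentiable psi (f q) by apply/derivable1_diffP.
have -> : dpsi * df = 'd psi (f q) df.
  by rewrite -[in RHS](mulr1 df) -pE deriveE // -/(df *: (1 : R)) linearZ mulrC.
exact: is_derive_comp.
Qed.

Section PointwiseDerive.
Context {R : realType} {W : normedModType R}.
Implicit Types (f g : W -> R) (q v : W).

(** The library rules speak of [f + g] and [f * g] as elements of function spaces; the lambda forms
    match the expressions differentiated below. *)
Lemma is_derive_fun_cst q v (a : R) : is_derive q v (fun=> a) 0.
Proof. exact: is_derive_cst. Qed.

Lemma is_derive_funD q v f g a b : is_derive q v f a -> is_derive q v g b ->
  is_derive q v (fun x => f x + g x) (a + b).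
Proof. exact: is_deriveD. Qed.

Lemma is_derive_funB q v f g a b : is_derive q v f a -> is_derive q v g b ->
  is_derive q v (fun x => f x - g x) (a - b).
Proof. exact: is_deriveB. Qed.

Lemma is_derive_funM q v f g a b : is_derive q v f a -> is_derive q v g b ->
  is_derive q v (fun x => f x * g x) (f q * b + g q * a).
Proof. exact: is_deriveM. Qed.

Lemma is_derive_fun_sum (I : Type) (r : seq I) (P : pred I) q v
    (F : I -> W -> R) (a : I -> R) :
  (forall i, P i -> is_derive q v (F i) (a i)) ->
  is_derive q v (fun x => \sum_(i <- r | P i) F i x) (\sum_(i <- r | P i) a i).
Proof.
move=> Fd; elim: r => [|i r IH].
  have -> : (fun x => \sum_(i <- [::] | P i) F i x) = fun=> 0.
    by apply/funext => x; rewrite big_nil.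
  by rewrite big_nil; exact: is_derive_fun_cst.
rewrite big_cons; case Pi : (P i).
  have -> : (fun x => \sum_(j <- i :: r | P j) F j x) =
      fun x => F i x + \sum_(j <- r | P j) F j x.
    by apply/funext => x; rewrite big_cons Pi.
  by apply: is_derive_funD => //; exact: Fd.
suff -> : (fun x => \sum_(j <- i :: r | P j) F j x) =
    fun x => \sum_(j <- r | P j) F j x by [].
by apply/funext => x; rewrite big_cons Pi.
Qed.

End PointwiseDerive.

(** * Smooth functions relative to a family of directions *)

Section SmoothClass.
Context {R : realType} {W : normedModType R} {K : Type}.
Variables (e : K -> W) (D : set W).
Hypothesis oD : open D.

(** The innermost derivative is peeled off first, so that product, quotient and power rules go by
    induction on the order. The family [e] is left open to serve both the coordinates of a chart and
    those of TM. *)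
Fixpoint Cn (k : nat) (f : W -> R) : Prop :=
  if k is k'.+1 then
    (forall q, D q -> differentiable f q) /\ forall z, Cn k' ('D_(e z) f)
  else True.

Definition Cinf f := forall k, Cn k f.

Lemma near_in_open (P : W -> Prop) q : D q -> (forall q, D q -> P q) ->
  \near q, P q.
Proof. by move=> Dq DP; apply: filterS DP _; exact: open_nbhs_nbhs. Qed.

Lemma derive_eq_on (f g : W -> R) (v q : W) :
  D q -> (forall q, D q -> f q = g q) -> 'D_v f q = 'D_v g q.
Proof. by move=> Dq fg; apply: near_eq_derive; exact: near_in_open. Qed.

(** Expressions in charts are total functions with arbitrary values off [D]; as [D] is open,
    derivatives of any order inside it do not see these values. *)
Lemma Cn_eq_on k (f g : W -> R) :
  (forall q, D q -> f q = g q) -> Cn k f -> Cn k g.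
Proof.
elim: k f g => [//|k IH] f g fg [fd fC]; split=> [q Dq|z].
  by apply: near_eq_differentiable (fd q Dq); exact: near_in_open.
by apply: (IH _ _ _ (fC z)) => q Dq; exact: derive_eq_on.
Qed.

Lemma CnW k f : Cn k.+1 f -> Cn k f.
Proof.
elim: k f => [//|k IH] f [fd fC]; split=> // z; apply: IH; exact: fC.
Qed.

Lemma CnS k f : (forall q, D q -> differentiable f q) ->
  (forall z, Cn k ('D_(e z) f)) -> Cn k.+1 f.
Proof. by []. Qed.

Lemma Cn_cst k (a : R) : Cn k (fun=> a).
Proof.
elim: k a => [//|k IH] a; split=> [q _|z]; first exact: differentiable_cst.
have -> : 'D_(e z) (fun=> a) = fun=> 0 by apply/funext => q; exact: derive_cst.
exact: IH.
Qed.

Lemma CnD k f g : Cn k f -> Cn k g -> Cn k (fun q => f q + g q).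
Proof.
elim: k f g => [//|k IH] f g [fd fC] [gd gC]; apply: CnS => [q Dq|z].
  by apply: differentiableD; [exact: fd|exact: gd].
apply: Cn_eq_on (IH _ _ (fC z) (gC z)) => q Dq.
by rewrite [in RHS]deriveD //; apply: diff_derivable; [exact: fd|exact: gd].
Qed.

Lemma CnM k f g : Cn k f -> Cn k g -> Cn k (fun q => f q * g q).
Proof.
elim: k f g => [//|k IH] f g Cf Cg; apply: CnS => [q Dq|z].
  by apply: differentiableM; [exact: Cf.1|exact: Cg.1].
apply: Cn_eq_on (CnD (IH _ _ (CnW Cf) (Cg.2 z)) (IH _ _ (CnW Cg) (Cf.2 z))) => q Dq.
by rewrite [in RHS]deriveM //; apply: diff_derivable; [exact: Cf.1|exact: Cg.1].
Qed.

Lemma Cn_sum k (I : Type) (r : seq I) (P : pred I) (F : I -> W -> R) :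
  (forall i, P i -> Cn k (F i)) -> Cn k (fun q => \sum_(i <- r | P i) F i q).
Proof.
move=> FC; elim: r => [|i r IH].
  by apply: Cn_eq_on (Cn_cst k 0) => q _; rewrite big_nil.
case Pi : (P i).
  by apply: Cn_eq_on (CnD (FC i Pi) IH) => q _; rewrite big_cons Pi.
by apply: Cn_eq_on IH => q _; rewrite big_cons Pi.
Qed.

Lemma Cn_prod k (I : Type) (r : seq I) (P : pred I) (F : I -> W -> R) :
  (forall i, P i -> Cn k (F i)) -> Cn k (fun q => \prod_(i <- r | P i) F i q).
Proof.
move=> FC; elim: r => [|i r IH].
  by apply: Cn_eq_on (Cn_cst k 1) => q _; rewrite big_nil.
case Pi : (P i).
  by apply: Cn_eq_on (CnM (FC i Pi) IH) => q _; rewrite big_cons Pi.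
by apply: Cn_eq_on IH => q _; rewrite big_cons Pi.
Qed.

(** The derivative of the inverse involves the inverse itself only at the lower order, which closes
    the induction. *)
Lemma CnV k f : (forall q, D q -> f q != 0) -> Cn k f ->
  Cn k (fun q => (f q)^-1).
Proof.
move=> f0; elim: k => [//|k IH] Cf; apply: CnS => [q Dq|z].
  by apply: differentiableV; [exact: Cf.1|exact: f0].
have Ci := IH (CnW Cf).
apply: Cn_eq_on (CnM (CnM (Cn_cst k (-1)) (CnM Ci Ci)) (Cf.2 z)) => q Dq.
rewrite [in RHS]deriveV ?f0 //; last by apply: diff_derivable; exact: Cf.1.
by rewrite -[RHS]/(- (f q) ^- 2 * 'D_(e z) f q) -exprVn expr2; ring.
Qed.

Lemma derive_powR (f : W -> R) (a : R) (v q : W) :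
  0 < f q -> derivable f q v ->
  is_derive q v (fun q => f q `^ a) (a * f q `^ (a - 1) * 'D_v f q).
Proof.
move=> fq /derivableP fd'; exact: is_derive_scalar_comp (is_derive1_powR a fq) fd'.
Qed.

(** The induction covers all exponents at once, because differentiating replaces [a] by [a - 1]. *)
Lemma Cn_powR k f a : (forall q, D q -> 0 < f q) -> Cn k f ->
  Cn k (fun q => f q `^ a).
Proof.
move=> f0; elim: k a => [//|k IH] a Cf; apply: CnS => [q Dq|z].
  have [pd _] := is_derive1_powR a (f0 q Dq).
  apply: (@differentiable_comp _ _ _ _ f (fun x : R => x `^ a)); first exact: Cf.1.
  exact/derivable1_diffP.
have Ci := IH (a - 1) (CnW Cf).
apply: Cn_eq_on (CnM (CnM (Cn_cst k a) Ci) (Cf.2 z)) => q Dq.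
have fd : derivable f q (e z) by apply: diff_derivable; exact: Cf.1.
by have [_ ->] := derive_powR a (f0 q Dq) fd.
Qed.

Lemma Cinf_diff f q : Cinf f -> D q -> differentiable f q.
Proof. by move=> /(_ 1%N) [fd _]; exact: fd. Qed.

Lemma Cinf_derivable f q v : Cinf f -> D q -> derivable f q v.
Proof. by move=> fC Dq; apply: diff_derivable; exact: Cinf_diff. Qed.

Lemma Cinf_derive f z : Cinf f -> Cinf ('D_(e z) f).
Proof. by move=> fC k; have [_] := fC k.+1; apply. Qed.

Lemma Cinf_eq_on f g : (forall q, D q -> f q = g q) -> Cinf f -> Cinf g.
Proof. by move=> fg fC k; apply: Cn_eq_on (fC k). Qed.

Lemma Cinf_cst a : Cinf (fun=> a).
Proof. by move=> k; exact: Cn_cst. Qed.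

Lemma CinfD f g : Cinf f -> Cinf g -> Cinf (fun q => f q + g q).
Proof. by move=> Cf Cg k; apply: CnD. Qed.

Lemma CinfM f g : Cinf f -> Cinf g -> Cinf (fun q => f q * g q).
Proof. by move=> Cf Cg k; apply: CnM. Qed.

Lemma CinfN f : Cinf f -> Cinf (fun q => - f q).
Proof.
move=> Cf; apply: Cinf_eq_on (CinfM (Cinf_cst (-1)) Cf) => q _.
by rewrite mulN1r.
Qed.

Lemma CinfB f g : Cinf f -> Cinf g -> Cinf (fun q => f q - g q).
Proof. by move=> Cf Cg; apply: CinfD Cf (CinfN Cg). Qed.

Lemma Cinf_sum (I : Type) (r : seq I) (P : pred I) (F : I -> W -> R) :
  (forall i, P i -> Cinf (F i)) -> Cinf (fun q => \sum_(i <- r | P i) F i q).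
Proof. by move=> FC k; apply: Cn_sum => i Pi; exact: FC. Qed.

Lemma Cinf_prod (I : Type) (r : seq I) (P : pred I) (F : I -> W -> R) :
  (forall i, P i -> Cinf (F i)) -> Cinf (fun q => \prod_(i <- r | P i) F i q).
Proof. by move=> FC k; apply: Cn_prod => i Pi; exact: FC. Qed.

Lemma CinfV f : (forall q, D q -> f q != 0) -> Cinf f -> Cinf (fun q => (f q)^-1).
Proof. by move=> f0 Cf k; apply: CnV. Qed.

Lemma Cinf_powR f a : (forall q, D q -> 0 < f q) -> Cinf f ->
  Cinf (fun q => f q `^ a).
Proof. by move=> f0 Cf k; apply: Cn_powR. Qed.

Lemma Cinf_derive_commute f y z q : Cinf f -> D q ->
  'D_(e y) ('D_(e z) f) q = 'D_(e z) ('D_(e y) f) q.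
Proof.
move=> Cf Dq.
apply: (derive_commute oD Dq).
- by move=> *; exact: Cinf_diff.
- by move=> *; apply: Cinf_diff => //; exact: Cinf_derive.
- by move=> *; apply: Cinf_diff => //; exact: Cinf_derive.
- apply: differentiable_continuous; apply: Cinf_diff => //.
  by do 2 apply: Cinf_derive.
- apply: differentiable_continuous; apply: Cinf_diff => //.
  by do 2 apply: Cinf_derive.
Qed.

Lemma Cinf_det (n : nat) (A : W -> 'M[R]_n) :
  (forall i j, Cinf (fun q => A q i j)) -> Cinf (fun q => \det (A q)).
Proof.
move=> AC; apply: Cinf_sum => s _; apply: CinfM; first exact: Cinf_cst.
by apply: Cinf_prod.
Qed.

(** Cramer's rule: each entry is a cofactor divided by the determinant. *)
Lemma Cinf_invmx (n : nat) (A : W -> 'M[R]_n) i j :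
  (forall q, D q -> A q \in unitmx) ->
  (forall i j, Cinf (fun q => A q i j)) -> Cinf (fun q => invmx (A q) i j).
Proof.
move=> Au AC.
have Cc : Cinf (fun q => (\det (A q))^-1 * cofactor (A q) j i).
  apply: CinfM; first apply: CinfV.
  - by move=> q Dq; have := Au q Dq; rewrite unitmxE unitfE.
  - exact: Cinf_det.
  - apply: CinfM; first exact: Cinf_cst.
    apply: (@Cinf_det _ (fun q => row' j (col' i (A q)))) => k l.
    by apply: Cinf_eq_on (AC (lift j k) (lift i l)) => q _; rewrite !mxE.
by apply: Cinf_eq_on Cc => q Dq; rewrite /invmx Au // !mxE.
Qed.

End SmoothClass.

(** * Primitives, inverse functions and Picard iteration *)

Section Primitive.
Context {R : realType}.
Implicit Types (f g : R -> R) (J : set R).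

Lemma open_right_point J x : open J -> J x -> exists2 u, J u & x < u.
Proof.
move=> oJ Jx; have : nbhs x J by exact: open_nbhs_nbhs.
move/nbhs_normP => [r /= r0 rJ]; exists (x + r / 2); last by rewrite ltrDl divr_gt0.
apply: rJ => /=; rewrite opprD addrA subrr add0r normrN gtr0_norm ?divr_gt0 //.
by rewrite gtr_pMr // invf_lt1 // ltr1n.
Qed.

Lemma open_left_point J x : open J -> J x -> exists2 u, J u & u < x.
Proof.
move=> oJ Jx; have : nbhs x J by exact: open_nbhs_nbhs.
move/nbhs_normP => [r /= r0 rJ]; exists (x - r / 2); last by rewrite ltrBlDr ltrDl divr_gt0.
apply: rJ => /=; rewrite opprB addrC subrK gtr0_norm ?divr_gt0 //.
by rewrite gtr_pMr // invf_lt1 // ltr1n.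
Qed.

(** The integral from [a] yields a derivative only to the right of [a]; [primitive] removes this
    restriction. *)
Lemma primitive_right J f a : open J -> is_interval J -> J a ->
  (forall t, J t -> {for t, continuous f}) ->
  exists F : R -> R, forall t, J t -> a < t -> is_derive t 1 F (f t).
Proof.
move=> oJ iJ Ja cf.
exists (fun x => (\int[lebesgue_measure]_(t in [set` `[a, x]]) f t)%R) => t Jt at_.
have [u Ju tu] := open_right_point oJ Jt.
have [] := @continuous_FTC1_closed R f a t u tu _ at_ (cf t Jt).
  apply: continuous_compact_integrable; first exact: segment_compact.
  apply: continuous_in_subspaceT => x; rewrite inE /= in_itv /= => /andP[ax xu].
  by apply: cf; apply: (iJ _ _ Ja Ju _); rewrite ax xu.
by move=> dF FE; split; [exact: dF|rewrite -derive1E; exact: FE].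
Qed.

Lemma is_derive_eq_cst J f g h x y : is_interval J -> J x -> J y ->
  (forall t, J t -> is_derive t 1 f (h t)) ->
  (forall t, J t -> is_derive t 1 g (h t)) ->
  f x - f y = g x - g y.
Proof.
move=> iJ; wlog xy : x y / x <= y.
  move=> H Jx Jy fd gd; have [xy|/ltW yx] := leP x y; first exact: H.
  by apply/eqP; rewrite -eqr_opp !opprB; apply/eqP; apply: H.
move=> Jx Jy fd gd.
have d t : x <= t <= y -> is_derive t 1 (fun t => f t - g t) (h t - h t).
  move=> xty; have Jt : J t by exact: (iJ _ _ Jx Jy _).
  by apply: is_derive_funB; [exact: fd|exact: gd].
have [c _] := mean_value xy d.
rewrite subrr mul0r => H; lra.
Qed.

(** Each [t] receives a base point [al t] to the left of [t] and [t0]. The integral from it,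
    normalized to vanish at [t0], does not depend on the base point, so near [t] the function
    coincides with one fixed integral. *)
Lemma primitive J f t0 : open J -> is_interval J -> J t0 ->
  (forall t, J t -> {for t, continuous f}) ->
  exists F : R -> R, F t0 = 0 /\ forall t, J t -> is_derive t 1 F (f t).
Proof.
move=> oJ iJ Jt0 cf.
have : forall t, exists a, J t -> [/\ J a, a < t & a < t0].
  move=> t; have [Jt|nJ] := pselect (J t); last by exists 0.
  have Jm : J (Order.min t t0) by rewrite /Order.min; case: ifP.
  have [a Ja] := open_left_point oJ Jm; rewrite lt_min => /andP[a1 a2].
  by exists a.
move=> /choice[al alP].
have : forall a, exists F : R -> R, J a -> forall t, J t -> a < t -> is_derive t 1 F (f t).
  move=> a; have [Ja|nJ] := pselect (J a); last by exists f.
  by have [F FP] := primitive_right oJ iJ Ja cf; exists F.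
move=> /choice[F FP].
exists (fun t => F (al t) t - F (al t) t0); split; first by rewrite subrr.
move=> t Jt; have [Ja at_ at0] := alP t Jt.
have : is_derive t 1 (fun s => F (al t) s - F (al t) t0) (f t).
  rewrite -[f t]subr0; exact: is_derive_funB (FP _ Ja t Jt at_) (is_derive_fun_cst _ _ _).
apply: near_eq_is_derive.
have : nbhs t (J `&` [set s | al t < s]).
  apply: open_nbhs_nbhs; split=> //; apply: openI => //; exact: open_gt.
apply: filterS => s [Js /= as_].
have [Jb bs b0] := alP s Js.
pose m := Order.max (al t) (al s).
have iJ' : is_interval (J `&` [set s | m < s]).
  move=> x y [Jx mx] [Jy my] z /andP[xz zy]; split; last exact: lt_le_trans mx xz.
  by apply: (iJ _ _ Jx Jy _); rewrite xz.
apply: (is_derive_eq_cst (J := J `&` [set s | m < s]) (h := f)) => //.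
- by split=> //=; rewrite gt_max as_.
- by split=> //=; rewrite gt_max at0.
- by move=> r [Jr]; rewrite /= gt_max => /andP[? ?]; exact: FP.
- by move=> r [Jr]; rewrite /= gt_max => /andP[? ?]; exact: FP.
Qed.

Lemma increasing_inverse J f df : open J -> is_interval J -> J !=set0 ->
  (forall t, J t -> is_derive t 1 f (df t)) -> (forall t, J t -> 0 < df t) ->
  [/\ open (f @` J), is_interval (f @` J) &
   exists g : R -> R, forall t, J t -> g (f t) = t /\ is_derive (f t) 1 g (df t)^-1].
Proof.
move=> oJ iJ [t0 Jt0] fd df0.
have inc x y : J x -> J y -> x < y -> f x < f y.
  move=> Jx Jy xy.
  have d t : x <= t <= y -> is_derive t 1 f (df t).
    by move=> xty; apply: fd; exact: (iJ _ _ Jx Jy _).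
  have [c xcy E] := mean_value (ltW xy) d.
  by rewrite -subr_gt0 E mulr_gt0 ?subr_gt0 //; apply: df0; exact: (iJ _ _ Jx Jy _ xcy).
have inj x y : J x -> J y -> f x = f y -> x = y.
  move=> Jx Jy E; have [xy|yx|//] := ltgtP x y.
    by have := inc _ _ Jx Jy xy; rewrite E ltxx.
  by have := inc _ _ Jy Jx yx; rewrite E ltxx.
have fc t : J t -> {for t, continuous f}.
  move=> Jt; apply/differentiable_continuous/derivable1_diffP.
  by have [] := fd t Jt.
(* The preimage is unique by strict monotonicity; off the image of [J] the value [t0] is a mere
   default. *)
pose g y := xget t0 [set t | J t /\ f t = y].
have fK t : J t -> g (f t) = t.
  move=> Jt; rewrite /g.
  by case: xgetP => [x -> [Jx E]|/(_ t)[]//]; apply: inj.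
have fK' t : J t -> {near t, cancel f g}.
  by move=> Jt; apply: filterS fK _; exact: open_nbhs_nbhs.
have fc' t : J t -> {near t, continuous f}.
  by move=> Jt; apply: filterS fc _; exact: open_nbhs_nbhs.
split.
- rewrite openE => _ [t Jt <-].
  have [gc gK] := near_can_continuousAcan_sym (fK' t Jt) (fc' t Jt).
  have : {for f t, continuous g} by exact: nbhs_singleton gc.
  move=> /(_ J); rewrite fK // => /(_ (open_nbhs_nbhs (conj oJ Jt))) Jg.
  by apply: filterS2 gK Jg => y gy Jy; exists (g y).
- apply/connected_intervalP; apply: connected_continuous_connected.
    exact/connected_intervalP.
  by apply: continuous_in_subspaceT => x /set_mem; exact: fc.
- exists g => t Jt; split; first exact: fK.
  apply: is_derive_inverse => //; [exact: fK'|exact: fc'|exact: fd|].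
  by rewrite gt_eqF ?df0.
Qed.

End Primitive.

Lemma open_symmetric_interval {R : realType} (e : R) : open [set s : R | - e < s < e].
Proof.
rewrite (_ : mkset _ = [set` `](- e), e[]); first exact: interval_open.
by apply/seteqP; split=> s /=; rewrite in_itv.
Qed.

Lemma is_interval_symmetric {R : realType} (e : R) :
  is_interval [set s : R | - e < s < e].
Proof.
move=> x y /andP[x1 _] /andP[_ y2] z /andP[xz zy] /=.
by rewrite (lt_le_trans x1) //= (le_lt_trans zy).
Qed.

(** * Picard iteration in finitely many real unknowns *)

Section Picard.
Context {R : realType} {K : finType}.
Implicit Types (f : K -> (K -> R) -> R) (a b : K -> R) (u : K -> R -> R).

(** The supremum norm is expressed through a bound [d] common to all coordinates, so no norm has to
    be put on [K -> R]. *)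
Definition lipschitz_near f a (r Lam : R) := forall k b c d,
  (forall j, `|b j - a j| <= r) -> (forall j, `|c j - a j| <= r) ->
  (forall j, `|b j - c j| <= d) -> `|f k b - f k c| <= Lam * d.

Definition lipschitz_all f (Lam : R) := forall k b c d,
  (forall j, `|b j - c j| <= d) -> `|f k b - f k c| <= Lam * d.

Lemma small_geometric (c e : R) : 0 < e -> exists m, c / 2 ^+ m < e.
Proof.
move=> e0; pose m := Num.bound (c / e); exists m.
rewrite ltr_pdivrMr ?exprn_gt0 // mulrC -ltr_pdivrMr //.
have [c0|c0] := leP (c / e) 0; first by rewrite (le_lt_trans c0) ?exprn_gt0.
apply: (lt_le_trans (archi_boundP (ltW c0))).
by rewrite -natrX ler_nat ltnW // ltn_expl.
Qed.

Lemma bound_from_derivative (g dg : R -> R) (eps M : R) : g 0 = 0 -> 0 <= M ->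
  (forall t : R, `|t| < eps -> is_derive t 1 g (dg t)) ->
  (forall t, `|t| < eps -> `|dg t| <= M) ->
  forall t, `|t| < eps -> `|g t| <= M * eps.
Proof.
move=> g0 M0 gd dgM t te.
have e0 : 0 < eps by apply: le_lt_trans te.
have [t0|/ltW t0] := leP 0 t.
  have inI s : 0 <= s <= t -> `|s| < eps.
    move=> /andP[s0 st]; rewrite ger0_norm // (le_lt_trans st) //.
    by rewrite -(ger0_norm t0).
  have [c ct] := mean_value t0 (fun s H => gd s (inI s H)).
  rewrite g0 !subr0 => ->; rewrite normrM ler_pM ?normr_ge0 //.
    exact/dgM/inI.
  exact: ltW.
have inI s : t <= s <= 0 -> `|s| < eps.
  move=> /andP[st s0]; rewrite ler0_norm // (le_lt_trans _ te) //.
  by rewrite (ler0_norm t0) lerN2.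
have [c ct] := mean_value t0 (fun s H => gd s (inI s H)).
rewrite g0 !sub0r => /eqP; rewrite eqr_oppLR => /eqP ->.
rewrite normrN normrM normrN ler_pM ?normr_ge0 //.
  exact/dgM/inI.
exact: ltW.
Qed.

Lemma lipschitz_comp_continuous f Lam u t k : 0 < Lam -> lipschitz_all f Lam ->
  (forall j, {for t, continuous (u j)}) ->
  {for t, continuous (fun s => f k (u^~ s))}.
Proof.
move=> L0 fL uc; apply/cvgrPdist_le => e e0.
have eL : 0 < e / Lam by rewrite divr_gt0.
have : \forall s \near t, forall j, `|u j t - u j s| <= e / Lam.
  have H := @filter_forall R K (fun j s => `|u j t - u j s| <= e / Lam) (nbhs t) _.
  apply: H => j; by move: (uc j) => /cvgrPdist_le; apply.
apply: filterS => s Hs; rewrite (le_trans (fL k _ _ _ Hs)) //.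
by rewrite mulrC divfK // gt_eqF.
Qed.

Section Global.
Variables (f : K -> (K -> R) -> R) (a0 : K -> R) (Lam : R).
Hypotheses (L0 : 0 < Lam) (fL : lipschitz_all f Lam).

(** A total choice of primitive lets the iteration be a plain [Fixpoint]. The default is never met,
    since all iterates turn out continuous. *)
Let prim : (R -> R) -> R -> R := fun g =>
  xget (fun=> 0) [set F : R -> R | F 0 = 0 /\ forall t : R, is_derive t 1 F (g t)].

Let primP g : continuous g -> prim g 0 = 0 /\ forall t : R, is_derive t 1 (prim g) (g t).
Proof.
move=> cg; rewrite /prim.
have [F [F0 Fd]] : exists F : R -> R, F 0 = 0 /\ forall t : R, setT t -> is_derive t 1 F (g t).
  apply: (@primitive R setT g 0) => //; [exact: openT|by move=> t _; exact: cg].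
by case: xgetP => [G -> //|/(_ F)[]]; split=> // t; exact: Fd.
Qed.

Fixpoint picard_iter (m : nat) : K -> R -> R :=
  if m is m'.+1 then
    fun k t => a0 k + prim (fun s => f k (fun j => picard_iter m' j s)) t
  else fun k _ => a0 k.

Local Notation U := picard_iter.

Let rhs_cont u k : (forall j, continuous (u j)) -> continuous (fun s => f k (u^~ s)).
Proof.
by move=> uc t; apply: lipschitz_comp_continuous fL _ => // j; exact: uc.
Qed.

Let U_cont m k : continuous (U m k).
Proof.
elim: m k => [|m IH] k; first exact: cst_continuous.
move=> t; apply: continuousD; first exact: cst_continuous.
have [_ pd] := primP (rhs_cont (k := k) IH).
apply/differentiable_continuous/derivable1_diffP.
by have [] := pd t.
Qed.

Let U0 m k : U m k 0 = a0 k.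
Proof.
case: m => [//|m] /=.
by have [-> _] := primP (rhs_cont (k := k) (@U_cont m)); rewrite addr0.
Qed.

Let U_derive m k (t : R) : is_derive t 1 (U m.+1 k) (f k (fun j => U m j t)).
Proof.
have [_ pd] := primP (rhs_cont (k := k) (@U_cont m)).
rewrite -[f k _]add0r /=.
exact: is_derive_funD (is_derive_fun_cst _ _ _) (pd t).
Qed.

(** With [Lam * eps = 1/2] the Picard operator halves distances on [|t| < eps]; hence the powers of
    2 in the error bounds. *)
Let eps := (2 * Lam)^-1.
Let e0 : 0 < eps. Proof. by rewrite invr_gt0 mulr_gt0. Qed.
Let Leps : Lam * eps = 2^-1.
Proof. by rewrite /eps invfM mulrCA mulfV ?mulr1 // gt_eqF. Qed.

(** Bounds the first step: the first iterate has constant derivative [f k a0], over a time less than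
    [eps]. *)
Let C := (\sum_k `|f k a0|) * eps.
Let C0 : 0 <= C. Proof. by rewrite mulr_ge0 ?(ltW e0) //; exact: sumr_ge0. Qed.

Let U_step m k t : `|t| < eps -> `|U m.+1 k t - U m k t| <= C / 2 ^+ m.
Proof.
elim: m k t => [|m IH] k t te.
  rewrite expr0 divr1 /C.
  apply: (@bound_from_derivative (fun t => U 1 k t - U 0 k t)
     (fun t => f k (fun j => U 0 j t) - 0)) te => //.
  - by rewrite !U0 subrr.
  - exact: sumr_ge0.
  - by move=> s _; apply: is_derive_funB (U_derive 0 k s) (is_derive_fun_cst _ _ _).
  - move=> s _; rewrite subr0 (bigD1 k) //= lerDl; exact: sumr_ge0.
have -> : C / 2 ^+ m.+1 = Lam * (C / 2 ^+ m) * eps.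
  rewrite [RHS](_ : _ = (Lam * eps) * (C / 2 ^+ m)); last by ring.
  by rewrite Leps exprS invfM; ring.
apply: (@bound_from_derivative (fun t => U m.+2 k t - U m.+1 k t)
  (fun t => f k (fun j => U m.+1 j t) - f k (fun j => U m j t))) te => //.
- by rewrite !U0 subrr.
- by rewrite mulr_ge0 ?(ltW L0) // divr_ge0 // exprn_ge0.
- by move=> s _; apply: is_derive_funB; exact: U_derive.
- by move=> s se; apply: fL => j; exact: IH.
Qed.

Let U_tail m p k t : `|t| < eps ->
  `|U (m + p) k t - U m k t| <= 2 * (C / 2 ^+ m).
Proof.
(* The partial geometric sum, with its negative term, is what survives the induction; the bare bound
   [2 C / 2^m] would not. *)
move=> te; apply: (@le_trans _ _ (2 * (C / 2 ^+ m) - 2 * (C / 2 ^+ (m + p)))).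
  elim: p => [|p IH]; first by rewrite addn0 !subrr normr0.
  rewrite addnS.
  have -> : U (m + p).+1 k t - U m k t =
     (U (m + p).+1 k t - U (m + p)%N k t) + (U (m + p)%N k t - U m k t) by ring.
  rewrite (le_trans (ler_normD _ _)) // (le_trans (lerD (U_step _ _ te) IH)) //.
  by rewrite exprS invfM; lra.
by rewrite gerBl mulr_ge0 // divr_ge0 // exprn_ge0.
Qed.

(** The limit of the iterates, as the supremum of their lower error bounds: for [|t| < eps] each of
    these lies below every upper bound [U m + 2 C / 2^m], so the supremum is squeezed at every
    [m]. *)
Let W k t := sup [set x | exists m, x = U m k t - 2 * (C / 2 ^+ m)].

Let W_near m k t : `|t| < eps -> `|W k t - U m k t| <= 2 * (C / 2 ^+ m).
Proof.
move=> te.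
have ub n m' : U n k t - 2 * (C / 2 ^+ n) <= U m' k t + 2 * (C / 2 ^+ m').
  rewrite lerBlDr; have P i : 0 <= 2 * (C / 2 ^+ i) :> R.
    by rewrite mulr_ge0 // divr_ge0 // exprn_ge0.
  have [nm|/ltnW mn] := leqP n m'.
    have := U_tail n (m' - n) k te; rewrite subnKC // => /ler_normlP[H _].
    by have := P m'; lra.
  have := U_tail m' (n - m') k te; rewrite subnKC // => /ler_normlP[_ H].
  by have := P n; lra.
have hs : has_sup [set x | exists m, x = U m k t - 2 * (C / 2 ^+ m)].
  split; first by exists (U 0 k t - 2 * (C / 2 ^+ 0)); exists 0%N.
  by exists (U 0 k t + 2 * (C / 2 ^+ 0)) => _ [n ->].
have H1 : U m k t - 2 * (C / 2 ^+ m) <= W k t.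
  by apply: sup_upper_bound => //; exists m.
have H2 : W k t <= U m k t + 2 * (C / 2 ^+ m).
  by apply: ge_sup => [|_ [n ->]//]; case: hs.
by apply/ler_normlP; split; lra.
Qed.

Let W_cont k t : `|t| < eps -> {for t, continuous (W k)}.
Proof.
move=> te; apply/cvgrPdist_le => e ep.
have e3 : 0 < e / 3 by rewrite divr_gt0.
have [m] := small_geometric (2 * C) e3; rewrite -mulrA => Hm.
have n1 : \forall s \near t, `|s| < eps.
  have : nbhs t [set s : R | - eps < s < eps].
    by apply: open_nbhs_nbhs; split; [exact: open_symmetric_interval|rewrite /= -ltr_norml].
  by apply: filterS => s /=; rewrite ltr_norml.
have n2 : \forall s \near t, `|U m k t - U m k s| <= e / 3.
  by move: (@U_cont m k t) => /cvgrPdist_le; apply.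
apply: filterS2 n1 n2 => s se H.
have := W_near m k te; have := W_near m k se.
have -> : W k t - W k s = (W k t - U m k t) + (U m k t - U m k s) - (W k s - U m k s) by ring.
move=> H1 H2.
rewrite (le_trans (ler_normB _ _)) // (le_trans (lerD (ler_normD _ _) (lexx _))) //.
by lra.
Qed.

(** As a uniform limit [W] is only known to be continuous. It is compared with [a0 + F], where [F]
    is a primitive of the right-hand side along [W]: both are within a multiple of [2^-m] of
    [U m.+1], so they agree and [W] is differentiable. *)
Lemma picard_global : exists u eps', [/\ 0 < eps', (forall k, u k 0 = a0 k) &
  forall k (t : R), `|t| < eps' -> is_derive t 1 (u k) (f k (u^~ t))].
Proof.
exists W, eps; split => //.
  move=> k; apply/eqP; rewrite -subr_eq0 -normr_le0; apply/ler_addgt0Pr => e ep.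
  rewrite add0r; have [m] := small_geometric (2 * C) ep; rewrite -mulrA => Hm.
  rewrite -(U0 m k) (le_trans _ (ltW Hm)) //; apply: W_near.
  by rewrite normr0.
move=> k t te.
pose J := [set s : R | - eps < s < eps].
have JE s : J s <-> `|s| < eps by rewrite /J /= ltr_norml.
have oJ : open J by exact: open_symmetric_interval.
have iJ : is_interval J by exact: is_interval_symmetric.
have J0 : J 0 by apply/JE; rewrite normr0.
have [F [F0 Fd]] : exists F : R -> R, F 0 = 0 /\
    forall s : R, J s -> is_derive s 1 F (f k (W^~ s)).
  apply: primitive => // s /JE se.
  by apply: lipschitz_comp_continuous fL _ => // j; exact: W_cont.
have WF s : J s -> a0 k + F s = W k s.
  move=> Js; have se := (JE s).1 Js.
  apply/eqP; rewrite -subr_eq0 -normr_le0; apply/ler_addgt0Pr => e ep.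
  rewrite add0r; have [m Hm] := small_geometric (4 * C) ep.
  have B1 : `|a0 k + F s - U m.+1 k s| <= Lam * (2 * (C / 2 ^+ m)) * eps.
    apply: (@bound_from_derivative (fun s => a0 k + F s - U m.+1 k s)
      (fun s => 0 + f k (W^~ s) - f k (fun j => U m j s))) se => //.
    - by rewrite U0 F0 addr0 subrr.
    - by rewrite mulr_ge0 ?(ltW L0) // mulr_ge0 // divr_ge0 // exprn_ge0.
    - move=> r /JE re; apply: is_derive_funB (U_derive m k r).
      exact: is_derive_funD (is_derive_fun_cst _ _ _) (Fd r re).
    - by move=> r re; rewrite add0r; apply: fL => j; exact: W_near.
  have := W_near m.+1 k se.
  have -> : a0 k + F s - W k s =
    (a0 k + F s - U m.+1 k s) - (W k s - U m.+1 k s) by ring.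
  move=> B2; rewrite (le_trans (ler_normB _ _)) // (le_trans (lerD B1 B2)) //.
  apply: le_trans (ltW Hm).
  rewrite [X in X + _](_ : _ = (Lam * eps) * (2 * (C / 2 ^+ m))); last by ring.
  rewrite Leps exprS invfM; set X := 4 * C / _.
  have -> : 2 * (C * (2^-1 / 2 ^+ m)) = X / 4 by rewrite /X; field; rewrite expf_neq0.
  have -> : 2^-1 * (2 * (C / 2 ^+ m)) = X / 4 by rewrite /X; field; rewrite expf_neq0.
  have : 0 <= X by rewrite divr_ge0 ?exprn_ge0 // mulr_ge0.
  lra.
have Jt := (JE t).2 te.
have : is_derive t 1 (fun s => a0 k + F s) (0 + f k (W^~ t)).
  exact: is_derive_funD (is_derive_fun_cst _ _ _) (Fd t Jt).
rewrite add0r; apply: near_eq_is_derive.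
by apply: filterS WF _; exact: open_nbhs_nbhs.
Qed.

End Global.

(** The argument is clamped coordinatewise to the box of radius [r]. Clamping does not increase
    distances, so the clamped field is globally Lipschitz; for small times its solution stays in the
    box, where clamping does nothing. *)
Lemma picard f a0 (r Lam : R) : 0 < r -> 0 < Lam -> lipschitz_near f a0 r Lam ->
  exists u eps, [/\ 0 < eps, (forall k, u k 0 = a0 k) &
  forall k (t : R), `|t| < eps -> is_derive t 1 (u k) (f k (u^~ t))].
Proof.
move=> r0 L0 fL.
pose cl (b : K -> R) j := a0 j + Order.max (- r) (Order.min r (b j - a0 j)).
have clr b j : `|cl b j - a0 j| <= r.
  rewrite /cl addrAC subrr add0r ler_norml le_max lexx /=.
  by rewrite ge_max ge_min lexx /= andbT ge0_cp ?ltW.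
have clL b c j : `|cl b j - cl c j| <= `|b j - c j|.
  rewrite /cl; set x := b j - a0 j; set y := c j - a0 j.
  have -> : b j - c j = x - y by rewrite /x /y; ring.
  have clP z : [\/ z <= - r /\ Order.max (- r) (Order.min r z) = - r,
      - r <= z <= r /\ Order.max (- r) (Order.min r z) = z |
      r <= z /\ Order.max (- r) (Order.min r z) = r].
    case: (leP r z) => [rz|/ltW zr].
      by apply: Or33; split=> //; apply: max_r; lra.
    case: (leP (- r) z) => [rz|/ltW rz]; last by apply: Or31.
    by apply: Or32; split=> //; apply/andP.
  rewrite opprD addrACA subrr add0r.
  move: (Order.max _ _) (Order.max _ _) (clP x) (clP y) => X Y.
  by case=> [[? ->]|[/andP[? ?] ->]|[? ->]]; case=> [[? ->]|[/andP[? ?] ->]|[? ->]];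
    apply/ler_normlP; split; case: (ger0P (x - y)) => ?; lra.
have fcl : lipschitz_all (fun k b => f k (cl b)) Lam.
  move=> k b c d bc; apply: fL => // j.
  exact: le_trans (clL _ _ _) (bc j).
have [u [eps [e0 ua ud]]] := picard_global a0 L0 fcl.
have uc j : {for 0, continuous (u j)}.
  apply/differentiable_continuous/derivable1_diffP.
  by have [] := ud j 0 (eq_ind _ (fun x => x < eps) e0 _ (esym (normr0 _))).
have : \forall t \near 0, forall j, `|u j 0 - u j t| <= r.
  have H := @filter_forall R K (fun j t => `|u j 0 - u j t| <= r) (nbhs (0 : R)) _.
  by apply: H => j; move: (uc j) => /cvgrPdist_le; apply.
move/nbhs_normP => [d /= d0 ur].
exists u, (Order.min eps d); split => //; first by rewrite lt_min e0.
move=> k t; rewrite lt_min => /andP[te td].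
have -> : f k (u^~ t) = f k (cl (u^~ t)).
  congr (f k _); apply/funext => j; rewrite /cl.
  have : `|u j 0 - u j t| <= r by apply: ur => /=; rewrite sub0r normrN.
  rewrite ua distrC ler_norml => /andP[H1 H2].
  by rewrite min_r // max_r //; ring.
exact: ud.
Qed.

End Picard.

(** * Homogeneous functions on the tangent bundle *)

Section Directions.
Context {R : realType}.

(** The difference quotient already equals [f v] for every [h != 0]. *)
Lemma is_derive_linear {V W : normedModType R} (f : V -> W) (p v : V) :
  (forall (h : R) a b, f (h *: a + b) = h *: f a + f b) ->
  is_derive p v f (f v).
Proof.
move=> fl.
have c : h^-1 *: (f (h *: v + p) - f p) @[h --> (0 : R)^'] --> f v.
  apply: cvg_near_cst; near=> h.
  have h0 : h != 0 by near: h; exact: nbhs_dnbhs_neq.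
  by rewrite fl addrK scalerA mulVf // scale1r.
by split; [exact: cvgP c|exact: cvg_lim c].
Unshelve. all: by end_near. Qed.

Lemma is_derive_pair {U V W : normedModType R} (f : U -> V) (g : U -> W)
    (p v : U) a b : is_derive p v f a -> is_derive p v g b ->
  is_derive p v (fun q => (f q, g q)) (a, b).
Proof.
move=> [fd <-] [gd <-].
have c : h^-1 *: ((f (h *: v + p), g (h *: v + p)) - (f p, g p))
    @[h --> (0 : R)^'] --> ('D_v f p, 'D_v g p).
  have -> : (fun h : R => h^-1 *: ((f (h *: v + p), g (h *: v + p)) - (f p, g p)))
     = (fun h => (h^-1 *: (f (h *: v + p) - f p), h^-1 *: (g (h *: v + p) - g p))).
    by [].
  exact: cvg_pair.
by split; [exact: cvgP c|exact: cvg_lim c].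
Qed.

Lemma is_derive_row {U : normedModType R} {n : nat} (f : U -> 'rV[R]_n) (p v : U)
    (a : 'rV[R]_n) :
  (forall i, is_derive p v (fun q => f q 0 i) (a 0 i)) -> is_derive p v f a.
Proof.
move=> fd.
have df : derivable f p v.
  by apply/derivable_mxP => i j; rewrite (ord1 i); case: (fd j).
split => //; rewrite derive_mx //; apply/rowP => j; rewrite mxE.
by case: (fd j).
Qed.

Lemma is_derive_row_coord {U : normedModType R} {n : nat} (f : U -> 'rV[R]_n)
    (p v : U) (a : 'rV[R]_n) i :
  is_derive p v f a -> is_derive p v (fun q => f q 0 i) (a 0 i).
Proof.
move=> [fd <-]; split; first by move/derivable_mxP: (fd) => /(_ 0 i).
by rewrite derive_mx // mxE.
Qed.

End Directions.

Section Coordinates.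
Context {R : realType} {n : nat}.
Local Notation V := 'rV[R]_n.
Local Notation W := (V * V)%type.
Local Notation e := (@basis_vec R n).

(** One index type for the x- and y-directions of TM: derivatives along [inl i] and [inr i] are
    [ddx i] and [ddy i], and facts about both are proved once. *)
Definition dir (z : 'I_n + 'I_n) : W :=
  match z with inl i => (e i, 0) | inr i => (0, e i) end.

Lemma row_basis (a : V) : a = \sum_i a 0 i *: e i.
Proof. by rewrite [LHS]row_sum_delta. Qed.

Lemma pair_basis (a b : V) :
  (a, b) = \sum_i a 0 i *: dir (inl i) + \sum_i b 0 i *: dir (inr i).
Proof.
have E1 : \sum_i a 0 i *: dir (inl i) = (a, 0) :> W.
  rewrite {2}(row_basis a); elim/big_rec2 : _ => // i y x _ ->.
  by rewrite -[LHS]/(a 0 i *: e i + y, a 0 i *: (0 : V) + 0) scaler0 addr0.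
have E2 : \sum_i b 0 i *: dir (inr i) = (0, b) :> W.
  rewrite {2}(row_basis b); elim/big_rec2 : _ => // i y x _ ->.
  by rewrite -[LHS]/(b 0 i *: (0 : V) + 0, b 0 i *: e i + y) scaler0 addr0.
by rewrite E1 E2 -[RHS]/(a + 0, 0 + b) addr0 add0r.
Qed.

Lemma diff_rowE (f : V -> R) (x a : V) : differentiable f x ->
  'd f x a = \sum_i a 0 i * 'D_(e i) f x.
Proof.
move=> df; rewrite {1}(row_basis a) linear_sum; apply: eq_bigr => i _.
by rewrite linearZ /= -deriveE.
Qed.

Lemma diff_pairE (f : W -> R) (p : W) (a b : V) : differentiable f p ->
  'd f p (a, b) = \sum_i a 0 i * ddx i f p + \sum_i b 0 i * ddy i f p.
Proof.
move=> df; rewrite (pair_basis a b) linearD !linear_sum.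
by congr (_ + _); apply: eq_bigr => i _; rewrite linearZ /= -deriveE.
Qed.

Lemma is_derive_comp_row {U : normedModType R} (f : V -> R) (g : U -> V)
    (q v : U) (dg : V) :
  differentiable f (g q) -> is_derive q v g dg ->
  is_derive q v (f \o g) (\sum_i dg 0 i * 'D_(e i) f (g q)).
Proof. by move=> df gd; rewrite -diff_rowE //; exact: is_derive_comp. Qed.

Lemma is_derive_comp_pair {U : normedModType R} (f : W -> R) (x y : U -> V)
    (q v : U) (dx dy : V) :
  differentiable f (x q, y q) -> is_derive q v x dx -> is_derive q v y dy ->
  is_derive q v (fun z => f (x z, y z))
    (\sum_i dx 0 i * ddx i f (x q, y q) + \sum_i dy 0 i * ddy i f (x q, y q)).
Proof.
move=> df xd yd; rewrite -diff_pairE //.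
exact: (is_derive_comp (g := fun z => (x z, y z))) df (is_derive_pair xd yd).
Qed.

Lemma is_derive_fst (p v : W) : is_derive p v fst v.1.
Proof. exact: is_derive_linear. Qed.

Lemma is_derive_snd (p v : W) : is_derive p v snd v.2.
Proof. exact: is_derive_linear. Qed.

Lemma is_derive_snd_coord (p v : W) i : is_derive p v (fun q => q.2 0 i) (v.2 0 i).
Proof. by apply: is_derive_linear => h a b; rewrite !mxE. Qed.

Lemma differentiable_fst (p : W) : differentiable (fst : W -> V) p.
Proof. by apply: linear_differentiable => q; exact: cvg_fst. Qed.

Lemma differentiable_snd (p : W) : differentiable (snd : W -> V) p.
Proof. by apply: linear_differentiable => q; exact: cvg_snd. Qed.

(** [foldr] differentiates by the last index of the list first, so peeling the innermost derivative
    means appending an index with [rcons]. *)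
Lemma smooth_on_Cinf (U : set V) (f : V -> R) : smooth_on U f -> Cinf e U f.
Proof.
move=> fs k; elim: k f fs => [//|k IH] f fs; split=> [q Uq|i]; first exact: (fs [::]).
apply: IH => s x Ux; have := fs (rcons s i) x Ux.
by rewrite /iter_partial foldr_rcons.
Qed.

(** An x-derivative of the pulled back function is the pullback of a derivative, and y-derivatives
    vanish; induction on the order over all [f]. *)
Lemma Cinf_fst (U : set V) (f : V -> R) : open U -> Cinf e U f ->
  Cinf dir [set p : W | U p.1] (fun p => f p.1).
Proof.
move=> oU fC k; elim: k f fC => [//|k IH] f fC.
have oU' : open [set p : W | U p.1].
  by apply: open_comp => // p _; exact: cvg_fst.
have fd q : U q -> differentiable f q by apply: Cinf_diff.
split=> [q Uq|[i|i]].
- exact: (differentiable_comp (differentiable_fst q) (fd _ Uq)).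
- apply: (Cn_eq_on oU' _ (IH _ (Cinf_derive i fC))) => q Uq.
  have [_ ->] := is_derive_comp (fd _ Uq) (is_derive_fst q (dir (inl i))).
  by rewrite -deriveE //; exact: fd.
- apply: (Cn_eq_on oU' _ (Cn_cst _ _ k 0)) => q Uq.
  have [_ ->] := is_derive_comp (fd _ Uq) (is_derive_fst q (dir (inr i))).
  by rewrite linear0.
Qed.

Lemma Cinf_snd (D : set W) i : open D -> Cinf dir D (fun p : W => p.2 0 i).
Proof.
move=> oD [//|k]; split=> [q _|z].
  have dc : differentiable (fun N : V => N 0 i : R) q.2.
    exact: differentiable_coord.
  exact: (differentiable_comp (differentiable_snd q) dc).
apply: (Cn_eq_on oD _ (Cn_cst _ _ k ((dir z).2 0 i))) => q _.
by have [_ ->] := is_derive_snd_coord q (dir z) i.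
Qed.

Section Homogeneous.
Variable D : set W.
Hypothesis oD : open D.
Hypothesis cone : forall p (l : R), D p -> l != 0 -> D (p.1, l *: p.2).

(** Negative [l] are included: the regions used here are stable under them, and a geodesic traversed
    backwards needs them. *)
Definition homogeneous (m : nat) (f : W -> R) := forall p (l : R),
  D p -> l != 0 -> f (p.1, l *: p.2) = l ^+ m * f p.

Lemma derive_scaled (f : W -> R) (p : W) (l : R) (a b : V) :
  differentiable f (p.1, l *: p.2) ->
  is_derive p (a, b) (fun q => f (q.1, l *: q.2))
    (\sum_i a 0 i * ddx i f (p.1, l *: p.2) +
     l * \sum_i b 0 i * ddy i f (p.1, l *: p.2)).
Proof.
move=> df.
have -> : l * \sum_i b 0 i * ddy i f (p.1, l *: p.2) =
    \sum_i (l *: b) 0 i * ddy i f (p.1, l *: p.2).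
  by rewrite mulr_sumr; apply: eq_bigr => i _; rewrite mxE mulrA.
apply: is_derive_comp_pair => //; first exact: (is_derive_fst p (a, b)).
by apply: (is_derive_linear (f := fun q : W => l *: q.2)) => h c d /=;
  rewrite scalerDr !scalerA mulrC.
Qed.

(** The map [q |-> f (q.1, l q.2)] is differentiated along [(a, b)] by the chain rule and by
    homogeneity. Basis choices of [(a, b)] give the rules for [ddx] and, after cancelling one [l],
    for [ddy]. *)
Lemma homogeneous_derive m (f : W -> R) p (l : R) (a b : V) :
  Cinf dir D f -> homogeneous m f -> D p -> l != 0 ->
  \sum_i a 0 i * ddx i f (p.1, l *: p.2) +
     l * \sum_i b 0 i * ddy i f (p.1, l *: p.2) =
  l ^+ m * (\sum_i a 0 i * ddx i f p + \sum_i b 0 i * ddy i f p).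
Proof.
move=> fC fh Dp l0.
have df : differentiable f (p.1, l *: p.2) by apply: (Cinf_diff fC); exact: cone.
have dfp : differentiable f p by exact: (Cinf_diff fC).
have [_ <-] := derive_scaled a b df.
rewrite -diff_pairE -?surjective_pairing // -deriveE //.
rewrite (derive_eq_on (D := D) oD (g := fun q => l ^+ m * f q)) //; last first.
  by move=> q Dq; exact: fh.
have [_ ->] := is_derive_funM (is_derive_fun_cst p (a, b) (l ^+ m))
  (derivableP (@diff_derivable _ _ _ f p (a, b) dfp)).
by rewrite mulr0 addr0.
Qed.

Lemma sum_basis (g : 'I_n -> R) i : \sum_j (e i) 0 j * g j = g i.
Proof.
rewrite (bigD1 i) //= big1 ?addr0 => [|j ji]; rewrite mxE ?eqxx ?mul1r //.
by rewrite (negbTE ji) andbF mul0r.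
Qed.

Lemma sum_zero (g : 'I_n -> R) : \sum_j (0 : V) 0 j * g j = 0.
Proof. by rewrite big1 // => j _; rewrite mxE mul0r. Qed.

Lemma sum_basis_l (gx gy hx hy : 'I_n -> R) (l c : R) i :
  \sum_j (e i) 0 j * gx j + l * \sum_j (0 : V) 0 j * gy j =
  c * (\sum_j (e i) 0 j * hx j + \sum_j (0 : V) 0 j * hy j) -> gx i = c * hx i.
Proof.
by rewrite (sum_basis gx) (sum_basis hx) (sum_zero gy) (sum_zero hy) mulr0 !addr0.
Qed.

Lemma sum_basis_r (gx gy hx hy : 'I_n -> R) (l c : R) i :
  \sum_j (0 : V) 0 j * gx j + l * \sum_j (e i) 0 j * gy j =
  c * (\sum_j (0 : V) 0 j * hx j + \sum_j (e i) 0 j * hy j) -> l * gy i = c * hy i.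
Proof.
by rewrite (sum_basis gy) (sum_basis hy) (sum_zero gx) (sum_zero hx) !add0r.
Qed.

Lemma homogeneous_ddx m (f : W -> R) i :
  Cinf dir D f -> homogeneous m f -> homogeneous m (ddx i f).
Proof.
move=> fC fh p l Dp l0; exact: sum_basis_l (homogeneous_derive (e i) 0 fC fh Dp l0).
Qed.

Lemma homogeneous_ddy m (f : W -> R) i :
  Cinf dir D f -> homogeneous m.+1 f -> homogeneous m (ddy i f).
Proof.
move=> fC fh p l Dp l0; have := sum_basis_r (homogeneous_derive 0 (e i) fC fh Dp l0).
by rewrite exprS -mulrA; exact: mulfI.
Qed.

Lemma homogeneous_euler m (f : W -> R) p :
  Cinf dir D f -> homogeneous m f -> D p ->
  \sum_i p.2 0 i * ddy i f p = m%:R * f p.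
Proof.
move=> fC fh Dp.
have df : differentiable f (p.1, (1 : R) *: p.2).
  by rewrite scale1r -surjective_pairing; exact: (Cinf_diff fC).
have d2 : is_derive (1 : R) (1 : R) (fun l : R => l *: p.2) p.2.
  by rewrite -[X in is_derive _ _ _ X]scale1r; apply: (is_derive_linear (f := fun l : R => l *: p.2))
     => h a b; rewrite scalerDl scalerA.
have dc : is_derive (1 : R) (1 : R) (fun _ : R => p.1) (0 : V).
  exact: is_derive_cst.
have := is_derive_comp_pair (x := fun _ : R => p.1) df dc d2.
rewrite (sum_zero (fun i => ddx i f _)) add0r scale1r -surjective_pairing => d.
have d' : is_derive (1 : R) (1 : R) (fun l : R => l ^+ m * f p) (m%:R * f p).
  have dX : is_derive (1 : R) (1 : R) (fun l : R => l ^+ m) m%:R.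
    split; first exact: exprn_derivable.
    by rewrite exp_derive expr1n /GRing.scale /= !mulr1.
  have := is_derive_funM dX (is_derive_fun_cst _ _ (f p)).
  by rewrite mulr0 add0r mulrC.
have [_ <-] := d; have [_ <-] := d'.
apply: near_eq_derive.
have : nbhs (1 : R) [set l : R | l != 0].
  by apply: open_nbhs_nbhs; split; [exact: open_neq|exact: oner_neq0].
by apply: filterS => l l0; exact: fh.
Unshelve. all: by end_near. Qed.

End Homogeneous.

End Coordinates.

(** * Sprays of root metrics *)

(** The algebra of [euler_contract]: [X i r] and [Y i s] stand for the second derivatives of f in
    (x^r, y^i) and (y^s, y^i), and the hypotheses are Euler's identity in degrees 2 and 1. *)
Lemma contract_sums {R : realType} {n : nat} (y g a b : 'I_n -> R)
    (X Y : 'I_n -> 'I_n -> R) :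
  (forall r, \sum_i y i * X i r = 2%:R * a r) ->
  (forall s, \sum_i y i * Y i s = 1%:R * b s) ->
  \sum_i y i * (a i - \sum_r y r * X i r + 2 * \sum_s g s * Y i s) =
  - (\sum_r y r * a r - 2 * \sum_s g s * b s).
Proof.
move=> hX hY.
have EX : \sum_i y i * \sum_r y r * X i r = 2 * \sum_r y r * a r.
  under eq_bigr do rewrite mulr_sumr.
  rewrite exchange_big mulr_sumr; apply: eq_bigr => r _ /=.
  rewrite -[RHS]mulrCA -hX mulr_sumr; apply: eq_bigr => s _.
  by rewrite mulrCA.
have EY : \sum_i y i * \sum_s g s * Y i s = \sum_s g s * b s.
  under eq_bigr do rewrite mulr_sumr.
  rewrite exchange_big; apply: eq_bigr => r _ /=.
  rewrite -[b r]mul1r -hY mulr_sumr; apply: eq_bigr => s _.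
  by rewrite mulrCA.
have -> : \sum_i y i * (a i - \sum_r y r * X i r + 2 * \sum_s g s * Y i s) =
    \sum_i y i * a i - \sum_i y i * \sum_r y r * X i r +
    2 * \sum_i y i * \sum_s g s * Y i s.
  rewrite mulr_sumr -sumrB -big_split; apply: eq_bigr => i _ /=.
  by rewrite mulrDr mulrBr [_ * (2 * _)]mulrCA.
rewrite EX EY; ring.
Qed.

(** * Differentiation along the spray and Euler-Lagrange expressions of 1-forms *)

Section FormOperators.
Context {R : realType} {n : nat}.
Local Notation V := 'rV[R]_n.
Local Notation W := (V * V)%type.
Variables (D : set W) (G : 'I_n -> W -> R).
Hypothesis oD : open D.
Implicit Types (f g : W -> R) (w : 'I_n + 'I_n -> W -> R) (p : W).

(* For [w = df] these are f_{;0} and f_{;i} - f_{;r.i} y^r, the latter being the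
   Euler-Lagrange expression of f along the spray G. *)
Definition form_spray w p : R :=
  \sum_r p.2 0 r * w (inl r) p - 2 * \sum_s G s p * w (inr s) p.

Definition form_euler w (i : 'I_n) p : R :=
  w (inl i) p - \sum_r p.2 0 r * ddy i (w (inl r)) p
  + 2 * \sum_s G s p * ddy i (w (inr s)) p.

(** The operators above act on arbitrary families, not only on differentials, because products such
    as [f dg] have to be fed to them. *)
Definition dform f (z : 'I_n + 'I_n) p : R := 'D_(dir z) f p.

Lemma Cinf_dform f z : Cinf dir D f -> Cinf dir D (dform f z).
Proof. exact: Cinf_derive. Qed.

Lemma form_sprayD w w' p :
  form_spray (fun z q => w z q + w' z q) p = form_spray w p + form_spray w' p.
Proof.
rewrite /form_spray.
have -> : \sum_r p.2 0 r * (w (inl r) p + w' (inl r) p) =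
    \sum_r p.2 0 r * w (inl r) p + \sum_r p.2 0 r * w' (inl r) p.
  by rewrite -big_split; apply: eq_bigr => r _; rewrite mulrDr.
have -> : \sum_s G s p * (w (inr s) p + w' (inr s) p) =
    \sum_s G s p * w (inr s) p + \sum_s G s p * w' (inr s) p.
  by rewrite -big_split; apply: eq_bigr => r _; rewrite mulrDr.
ring.
Qed.

Lemma form_sprayM f w p : form_spray (fun z q => f q * w z q) p = f p * form_spray w p.
Proof.
rewrite /form_spray mulrBr [f p * (2 * _)]mulrCA.
by congr (_ - 2 * _); rewrite mulr_sumr; apply: eq_bigr => r _; rewrite mulrCA.
Qed.

Lemma ddyD i f g p : D p -> Cinf dir D f -> Cinf dir D g ->
  ddy i (fun q => f q + g q) p = ddy i f p + ddy i g p.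
Proof.
move=> Dp fC gC.
have [_ E] := is_derive_funD
  (derivableP (Cinf_derivable (v := (0, basis_vec R i)) fC Dp))
  (derivableP (Cinf_derivable (v := (0, basis_vec R i)) gC Dp)).
exact: E.
Qed.

Lemma ddyM i f g p : D p -> Cinf dir D f -> Cinf dir D g ->
  ddy i (fun q => f q * g q) p = f p * ddy i g p + g p * ddy i f p.
Proof.
move=> Dp fC gC.
have [_ E] := is_derive_funM
  (derivableP (Cinf_derivable (v := (0, basis_vec R i)) fC Dp))
  (derivableP (Cinf_derivable (v := (0, basis_vec R i)) gC Dp)).
exact: E.
Qed.

Lemma form_eulerD w w' i p : D p ->
  (forall z, Cinf dir D (w z)) -> (forall z, Cinf dir D (w' z)) ->
  form_euler (fun z q => w z q + w' z q) i p = form_euler w i p + form_euler w' i p.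
Proof.
move=> Dp wC wC'; rewrite /form_euler.
have -> : \sum_r p.2 0 r * ddy i (fun q => w (inl r) q + w' (inl r) q) p =
    \sum_r p.2 0 r * ddy i (w (inl r)) p + \sum_r p.2 0 r * ddy i (w' (inl r)) p.
  by rewrite -big_split; apply: eq_bigr => r _; rewrite ddyD // mulrDr.
have -> : \sum_s G s p * ddy i (fun q => w (inr s) q + w' (inr s) q) p =
    \sum_s G s p * ddy i (w (inr s)) p + \sum_s G s p * ddy i (w' (inr s)) p.
  by rewrite -big_split; apply: eq_bigr => r _; rewrite ddyD // mulrDr.
ring.
Qed.

(** The derivative in y^i also falls on [f], and what it multiplies, y^r w_r - 2 G^s w_s, is
    [form_spray w]. *)
Lemma form_eulerM f w i p : D p -> Cinf dir D f -> (forall z, Cinf dir D (w z)) ->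
  form_euler (fun z q => f q * w z q) i p =
  f p * form_euler w i p - ddy i f p * form_spray w p.
Proof.
move=> Dp fC wC; rewrite /form_euler /form_spray.
have -> : \sum_r p.2 0 r * ddy i (fun q => f q * w (inl r) q) p =
    f p * \sum_r p.2 0 r * ddy i (w (inl r)) p + ddy i f p * \sum_r p.2 0 r * w (inl r) p.
  rewrite !mulr_sumr -big_split; apply: eq_bigr => r _; rewrite ddyM //=.
  by set A := ddy _ _ _; set B := ddy _ _ _; ring.
have -> : \sum_s G s p * ddy i (fun q => f q * w (inr s) q) p =
    f p * \sum_s G s p * ddy i (w (inr s)) p + ddy i f p * \sum_s G s p * w (inr s) p.
  rewrite !mulr_sumr -big_split; apply: eq_bigr => r _; rewrite ddyM //=.
  by set A := ddy _ _ _; set B := ddy _ _ _; ring.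
set A := ddy i f p; move: A (\sum_r _) (\sum_r _) (\sum_s _) (\sum_s _) => A B C E F.
ring.
Qed.

Lemma form_spray_eq w w' p : D p -> (forall z q, D q -> w z q = w' z q) ->
  form_spray w p = form_spray w' p.
Proof.
move=> Dp ww; rewrite /form_spray.
by congr (_ - 2 * _); apply: eq_bigr => r _; rewrite ww.
Qed.

Lemma form_euler_eq w w' i p : D p -> (forall z q, D q -> w z q = w' z q) ->
  form_euler w i p = form_euler w' i p.
Proof.
move=> Dp ww; rewrite /form_euler.
have ddyE z : ddy i (w z) p = ddy i (w' z) p.
  by apply: (derive_eq_on (D := D)) => // q; exact: ww.
by congr (_ - _ + 2 * _); [exact: ww|apply: eq_bigr => r _|apply: eq_bigr => r _];
  congr (_ * _).
Qed.

Lemma dformM f g z p : D p -> Cinf dir D f -> Cinf dir D g ->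
  dform (fun q => f q * g q) z p = f p * dform g z p + g p * dform f z p.
Proof.
move=> Dp fC gC.
have [_ E] := is_derive_funM
  (derivableP (Cinf_derivable (v := dir z) fC Dp))
  (derivableP (Cinf_derivable (v := dir z) gC Dp)).
exact: E.
Qed.

Lemma spray_mul f g p : D p -> Cinf dir D f -> Cinf dir D g ->
  form_spray (dform (fun q => f q * g q)) p =
  f p * form_spray (dform g) p + g p * form_spray (dform f) p.
Proof.
move=> Dp fC gC.
rewrite (form_spray_eq (w' := fun z q => f q * dform g z q + g q * dform f z q)) //.
  by rewrite form_sprayD !form_sprayM.
by move=> z q Dq; exact: dformM.
Qed.

Lemma euler_mul f g i p : D p -> Cinf dir D f -> Cinf dir D g ->
  form_euler (dform (fun q => f q * g q)) i p =
  f p * form_euler (dform g) i p + g p * form_euler (dform f) i p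
  - (ddy i f p * form_spray (dform g) p + ddy i g p * form_spray (dform f) p).
Proof.
move=> Dp fC gC.
have fC' z := Cinf_dform z fC; have gC' z := Cinf_dform z gC.
rewrite (form_euler_eq (w' := fun z q => f q * dform g z q + g q * dform f z q)) //; last first.
  by move=> z q Dq; exact: dformM.
rewrite form_eulerD //; first last.
- by move=> z; exact: CinfM.
- by move=> z; exact: CinfM.
rewrite !form_eulerM //.
move: (ddy i f p) (ddy i g p) (form_euler _ _ _) (form_euler _ _ _) => A B C E.
ring.
Qed.

Lemma spray_relation f g h (c : R) p : D p ->
  (forall z q, D q -> f q * dform g z q = c * g q * dform h z q) ->
  f p * form_spray (dform g) p = c * g p * form_spray (dform h) p.
Proof.
move=> Dp E; rewrite -form_sprayM -(form_sprayM (fun q => c * g q)).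
exact: form_spray_eq.
Qed.

(** Both sides are a function times a differential, and [form_eulerM] applies to each. With [f = T],
    [g = F^2], [h = T], [c = 2/k] this links the two expressions without differentiating a power
    twice. *)
Lemma euler_relation f g h (c : R) i p : D p ->
  Cinf dir D f -> Cinf dir D g -> Cinf dir D h ->
  (forall z q, D q -> f q * dform g z q = c * g q * dform h z q) ->
  f p * form_euler (dform g) i p - ddy i f p * form_spray (dform g) p =
  c * g p * form_euler (dform h) i p - c * ddy i g p * form_spray (dform h) p.
Proof.
move=> Dp fC gC hC E.
have gC' z := Cinf_dform z gC; have hC' z := Cinf_dform z hC.
have cC : Cinf dir D (fun=> c) by exact: Cinf_cst.
have cgC : Cinf dir D (fun q => c * g q) by exact: CinfM.
have E1 := form_eulerM i Dp fC gC'.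
have E2 := form_euler_eq i Dp E.
have E3 := form_eulerM i Dp cgC hC'.
have E4 : ddy i (fun q => c * g q) p = c * ddy i g p.
  have E5 := ddyM i Dp cC gC.
  have E6 : ddy i (fun=> c) p = 0 by exact: derive_cst.
  by rewrite E5 E6 mulr0 addr0.
apply: etrans (esym E1) (etrans E2 (etrans E3 _)).
by congr (_ - _ * _).
Qed.

Lemma euler_contract (f : W -> R) p : D p ->
  (forall p (l : R), D p -> l != 0 -> D (p.1, l *: p.2)) ->
  Cinf dir D f -> homogeneous D 2 f ->
  \sum_i p.2 0 i * form_euler (dform f) i p = - form_spray (dform f) p.
Proof.
move=> Dp cone fC fh.
have hx r : \sum_i p.2 0 i * ddy i (ddx r f) p = 2%:R * ddx r f p.
  apply: (homogeneous_euler (D := D)) => //; first exact: (Cinf_dform (inl r)).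
  exact: homogeneous_ddx.
have hy s : \sum_i p.2 0 i * ddy i (ddy s f) p = 1%:R * ddy s f p.
  apply: (homogeneous_euler (D := D)) => //; first exact: (Cinf_dform (inr s)).
  exact: homogeneous_ddy.
exact: (@contract_sums _ _ (fun i => p.2 0 i) (G^~ p) _ _
  (fun i r => ddy i (ddx r f) p) (fun i r => ddy i (ddy r f) p) hx hy).
Qed.

End FormOperators.

(** [N] is the nonlinear connection and [M s r] the y^i-derivative of N^s_r. By the second
    hypothesis the two terms N^s_i f_{.s} cancel; by the first the remaining connection terms
    collapse to 2 G^s. *)
Lemma hderiv_sums {R : realType} {n : nat} (a : R) (y g X Y z : 'I_n -> R)
    (N M : 'I_n -> 'I_n -> R) i :
  (forall s, \sum_r y r * N s r = 2 * g s) ->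
  (forall s, \sum_r y r * M s r = N s i) ->
  a - \sum_s N s i * z s - \sum_r (X r - \sum_s (N s r * Y s + z s * M s r)) * y r =
  a - \sum_r y r * X r + 2 * \sum_s g s * Y s.
Proof.
move=> hN hM.
have -> : \sum_r (X r - \sum_s (N s r * Y s + z s * M s r)) * y r =
    \sum_r y r * X r - \sum_s (2 * g s * Y s + N s i * z s).
  have -> : \sum_s (2 * g s * Y s + N s i * z s) =
      \sum_s \sum_r y r * (N s r * Y s + z s * M s r).
    apply: eq_bigr => s _; rewrite -hN -hM !mulr_suml -big_split.
    by apply: eq_bigr => r _ /=; ring.
  rewrite exchange_big -sumrB; apply: eq_bigr => r _ /=.
  by rewrite -mulr_sumr -mulrBr mulrC.
rewrite big_split /= mulr_sumr.
have -> : \sum_s 2 * g s * Y s = \sum_s 2 * (g s * Y s).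
  by apply: eq_bigr => s _; rewrite mulrA.
ring.
Qed.

Lemma hderiv0_sums {R : realType} {n : nat} (y g X z : 'I_n -> R)
    (N : 'I_n -> 'I_n -> R) :
  (forall s, \sum_r y r * N s r = 2 * g s) ->
  \sum_r (X r - \sum_s N s r * z s) * y r =
  \sum_r y r * X r - 2 * \sum_s g s * z s.
Proof.
move=> hN; rewrite (_ : 2 * _ = \sum_r y r * \sum_s N s r * z s).
  by rewrite -sumrB; apply: eq_bigr => r _; rewrite mulrC mulrBr.
under [RHS]eq_bigr do rewrite mulr_sumr.
rewrite exchange_big mulr_sumr; apply: eq_bigr => s _ /=.
by rewrite mulrA -hN mulr_suml; apply: eq_bigr => r _; rewrite mulrA.
Qed.

(** Multiplication by the invertible matrix [2 g] carries the first system to the second. *)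
Lemma residual_matrix {R : realType} {n : nat} (g : 'M[R]_n) (b G : 'I_n -> R)
    (acc : 'rV[R]_n) : g \in unitmx ->
  (forall i, G i = 4^-1 * \sum_j invmx g i j * b j) ->
  (forall i, acc 0 i + 2 * G i = 0) <->
  (forall i, b i + 2 * \sum_l g i l * acc 0 l = 0).
Proof.
move=> gu GE; pose B : 'cV[R]_n := \col_j b j.
have GE' i : G i = 4^-1 * (invmx g *m B) i 0.
  by rewrite GE mxE; congr (_ * _); apply: eq_bigr => j _; rewrite [B _ _]mxE.
have aE i : \sum_l g i l * acc 0 l = (g *m acc^T) i 0.
  by rewrite mxE; apply: eq_bigr => l _; rewrite [acc^T _ _]mxE.
have BE i : b i = B i 0 by rewrite mxE.
split=> H.
  have E : acc^T = - (2^-1) *: (invmx g *m B).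
    apply/colP => i; rewrite [LHS]mxE [RHS]mxE; have := H i; rewrite GE'.
    by move: ((invmx g *m B) i 0) => X; lra.
  move=> i; rewrite aE E -scalemxAr mulKVmx // [(_ *: B) _ _]mxE BE.
  by field.
have E : g *m acc^T = - (2^-1) *: B.
  by apply/colP => i; rewrite [RHS]mxE; have := H i; rewrite aE BE; lra.
have E2 : acc^T = - (2^-1) *: (invmx g *m B).
  by rewrite -[LHS](mulKmx gu) E scalemxAr.
move=> i; have := congr1 (fun M : 'cV[R]_n => M i 0) E2.
rewrite [LHS]mxE [RHS]mxE GE' => ->.
by move: ((invmx g *m B) i 0) => X; lra.
Qed.

Lemma residual_sums {R : realType} {n : nat} (y acc g X Y : 'I_n -> R) (c : R) :
  (forall l, Y l = 2 * g l) ->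
  \sum_l y l * X l + \sum_l acc l * Y l - c =
  \sum_l X l * y l - c + 2 * \sum_l g l * acc l.
Proof.
move=> hY.
have -> : \sum_l acc l * Y l = 2 * \sum_l g l * acc l.
  by rewrite mulr_sumr; apply: eq_bigr => l _; rewrite hY; ring.
rewrite (eq_bigr (fun l => X l * y l)) => [|l _]; last by rewrite mulrC.
ring.
Qed.

(** In the acceleration - 2 (G + P y) the term P y meets only second y-derivatives, and Euler's
    identity in degree 1 evaluates it to - 2 P [a]. *)
Lemma residual_form_sums {R : realType} {n : nat} (y g X Y X' Y' : 'I_n -> R)
    (P c a : R) :
  (forall l, X l = X' l) -> (forall l, Y l = Y' l) ->
  \sum_l y l * Y l = 1%:R * a ->
  \sum_l y l * X l + \sum_l (\row_l (- (2 * (g l + P * y l)))) 0 l * Y l - c =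
  - (c - \sum_l y l * X' l + 2 * \sum_l g l * Y' l) - 2 * P * a.
Proof.
move=> hX hY ha.
have -> : \sum_l (\row_l (- (2 * (g l + P * y l)))) 0 l * Y l =
    - 2 * (\sum_l g l * Y' l) - 2 * P * a.
  rewrite -[a]mul1r -ha !mulr_sumr -sumrB; apply: eq_bigr => l _.
  by rewrite mxE -hY; ring.
rewrite (eq_bigr (fun l => y l * X' l)) => [|l _]; last by rewrite hX.
ring.
Qed.

(** * The spray of one root metric *)

Section RootSpray.
Context {R : realType} {n : nat}.
Local Notation V := 'rV[R]_n.
Local Notation W := (V * V)%type.
Variables (k : nat) (T : W -> R) (D : set W).
Hypotheses (oD : open D) (k0 : (0 < k)%N).
Hypothesis cone : forall p (l : R), D p -> l != 0 -> D (p.1, l *: p.2).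
Hypotheses (TC : Cinf dir D T) (T0 : forall p, D p -> T p != 0).
Hypothesis Thom : homogeneous D k T.
Hypothesis gU : forall p, D p -> fund_tensor k T p \in unitmx.

Local Notation L := (Fsq k T).
Local Notation G := (spray k T).

(** Squaring absorbs the sign convention of the odd root, so F^2 is a power of the positive quantity
    T^2 for either parity. *)
Lemma kroot_sqr (t : R) : t != 0 -> kroot k t ^+ 2 = (t * t) `^ (k%:R^-1).
Proof.
move=> t0; rewrite /kroot exprMn sqr_sg t0 mul1r expr2 -powRM //.
by rewrite -normrM ger0_norm // -expr2 sqr_ge0.
Qed.

Lemma FsqE p : D p -> L p = (T p * T p) `^ (k%:R^-1).
Proof. by move=> Dp; rewrite /Fsq kroot_sqr // T0. Qed.

Lemma sqr_form_gt0 p : D p -> 0 < T p * T p.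
Proof. by move=> Dp; rewrite -expr2 exprn_even_gt0 //= T0. Qed.

Lemma Fsq_gt0 p : D p -> 0 < L p.
Proof. by move=> Dp; rewrite FsqE // powR_gt0 // sqr_form_gt0. Qed.

Lemma Cinf_Fsq : Cinf dir D L.
Proof.
apply: (Cinf_eq_on oD (f := fun q => (T q * T q) `^ (k%:R^-1))).
  by move=> q Dq; rewrite FsqE.
apply: Cinf_powR => //; first exact: sqr_form_gt0.
exact: CinfM.
Qed.

Lemma homogeneous_Fsq : homogeneous D 2 L.
Proof.
move=> p l Dp l0; rewrite !FsqE //; last exact: cone.
rewrite Thom //.
have -> : l ^+ k * T p * (l ^+ k * T p) = (l ^+ 2) ^+ k * (T p * T p).
  by rewrite exprAC expr2; ring.
have h1 : 0 <= (l ^+ 2) ^+ k by apply: exprn_ge0; exact: sqr_ge0.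
rewrite (powRM _ h1 (ltW (sqr_form_gt0 Dp))).
by rewrite -powR_mulrn ?sqr_ge0 // -powRrM mulfV ?powRr1 ?sqr_ge0 // pnatr_eq0 -lt0n.
Qed.

(** The logarithmic derivative of F^2 = (T^2)^(1/k), cleared of denominators. *)
Lemma Fsq_relation z q : D q ->
  T q * dform L z q = 2 / k%:R * L q * dform T z q.
Proof.
move=> Dq.
have Td : is_derive q (dir z) T (dform T z q).
  exact/derivableP/(Cinf_derivable TC).
have TTd := is_derive_funM Td Td.
have E1 : dform L z q =
    k%:R^-1 * (T q * T q) `^ (k%:R^-1 - 1) * (T q * dform T z q + T q * dform T z q).
  have [_ <-] := is_derive_scalar_comp (f := fun x => T x * T x)
    (is_derive1_powR k%:R^-1 (sqr_form_gt0 Dq)) TTd.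
  rewrite /dform; apply: (derive_eq_on (D := D)) => // r Dr; exact: FsqE.
have p0 : 0 < k%:R^-1 :> R by rewrite invr_gt0 ltr0n.
rewrite E1 FsqE // -(mulr_powRB1 (ltW (sqr_form_gt0 Dq)) p0).
move: (dform T z q) (_ `^ _) => A B; ring.
Qed.

Lemma fund_tensorE i j q : fund_tensor k T q i j = 2^-1 * ddy i (ddy j L) q.
Proof. by rewrite mxE. Qed.

Lemma Cinf_fund_tensor i j : Cinf dir D (fun q => fund_tensor k T q i j).
Proof.
apply: (Cinf_eq_on oD (f := fun q => 2^-1 * ddy i (ddy j L) q)).
  by move=> q _; rewrite fund_tensorE.
apply: CinfM => //; first exact: Cinf_cst.
exact: (Cinf_dform (inr i) (Cinf_dform (inr j) Cinf_Fsq)).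
Qed.

Lemma Cinf_spray i : Cinf dir D (G i).
Proof.
apply: CinfM => //; first exact: Cinf_cst.
apply: Cinf_sum => // j _; apply: CinfM => //.
  apply: Cinf_invmx => //; exact: Cinf_fund_tensor.
apply: CinfB => //; last exact: (Cinf_dform (inl j) Cinf_Fsq).
apply: Cinf_sum => // l _; apply: CinfM => //; last exact: Cinf_snd.
exact: (Cinf_dform (inl l) (Cinf_dform (inr j) Cinf_Fsq)).
Qed.

(** The fundamental tensor has degree 0 and the bracket it multiplies has degree 2. *)
Lemma homogeneous_spray i : homogeneous D 2 (G i).
Proof.
move=> p l Dp l0.
have yC j : Cinf dir D (ddy j L) := Cinf_dform (inr j) Cinf_Fsq.
have yh j : homogeneous D 1 (ddy j L) by apply: homogeneous_ddy Cinf_Fsq homogeneous_Fsq.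
have yyh j j' : homogeneous D 0 (ddy j' (ddy j L)) by apply: homogeneous_ddy (yC j) (yh j).
have xyh j j' : homogeneous D 1 (ddx j' (ddy j L)) by apply: homogeneous_ddx (yC j) (yh j).
have xh j : homogeneous D 2 (ddx j L) by apply: homogeneous_ddx Cinf_Fsq homogeneous_Fsq.
have gE : fund_tensor k T (p.1, l *: p.2) = fund_tensor k T p.
  apply/matrixP => a b.
  apply: etrans (fund_tensorE a b _) (etrans _ (esym (fund_tensorE a b p))).
  apply: (congr1 (fun u => 2^-1 * u)).
  exact: etrans (yyh b a p l Dp l0) (mul1r _).
pose b j q := \sum_(r < n) ddx r (ddy j L) q * q.2 0 r - ddx j L q.
have bE j : b j (p.1, l *: p.2) = l ^+ 2 * b j p.
  rewrite /b mulrBr; congr (_ - _); last exact: xh.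
  rewrite mulr_sumr; apply: eq_bigr => r _.
  have E := xyh j r p l Dp l0.
  apply: etrans (congr1 (fun u => u * (l *: p.2) 0 r) E) _.
  rewrite mxE; move: (ddx _ _ _) (p.2 0 r) => A B; ring.
have GE q : G i q = 4^-1 * \sum_(j < n) invmx (fund_tensor k T q) i j * b j q by [].
rewrite !GE gE mulrCA; congr (_ * _); rewrite mulr_sumr.
by apply: eq_bigr => j _; rewrite bE mulrCA.
Qed.

Lemma spray_euler s p : D p -> \sum_r p.2 0 r * nonlin_conn k T s r p = 2 * G s p.
Proof. by move=> Dp; apply: homogeneous_euler (Cinf_spray s) (homogeneous_spray s) Dp. Qed.

Lemma Cinf_nonlin_conn s r : Cinf dir D (nonlin_conn k T s r).
Proof. exact: (Cinf_dform (inr r) (Cinf_spray s)). Qed.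

(* Differentiating [y^r N^s_r = 2 G^s]. *)
Lemma nonlin_conn_euler s i p : D p ->
  \sum_r p.2 0 r * ddy i (nonlin_conn k T s r) p = nonlin_conn k T s i p.
Proof.
move=> Dp.
have d1 : is_derive p (0, basis_vec R i)
    (fun q => \sum_r q.2 0 r * nonlin_conn k T s r q)
    (\sum_r (p.2 0 r * ddy i (nonlin_conn k T s r) p +
       nonlin_conn k T s r p * (basis_vec R i) 0 r)).
  apply: is_derive_fun_sum => r _; apply: is_derive_funM.
    exact: (is_derive_snd_coord p (0, basis_vec R i) r).
  exact/derivableP/(Cinf_derivable (Cinf_nonlin_conn s r)).
have d2 : is_derive p (0, basis_vec R i) (fun q => 2 * G s q)
    (2 * nonlin_conn k T s i p + G s p * 0).
  apply: is_derive_funM (is_derive_fun_cst _ _ _) _.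
  exact/derivableP/(Cinf_derivable (Cinf_spray s)).
have E : 'D_(0, basis_vec R i) (fun q : W => \sum_r q.2 0 r * nonlin_conn k T s r q) p
  = 'D_(0, basis_vec R i) (fun q : W => 2 * G s q) p.
  by apply: (derive_eq_on (D := D)) => // q Dq; exact: spray_euler.
case: d1 d2 => _ E1 [_ E2].
have := etrans (esym E1) (etrans E E2).
rewrite big_split /=.
have -> : \sum_r nonlin_conn k T s r p * (basis_vec R i) 0 r = nonlin_conn k T s i p.
  rewrite -[RHS](sum_basis (fun r => nonlin_conn k T s r p)).
  by apply: eq_bigr => r _; rewrite mulrC.
move: (nonlin_conn _ _ _ _ _) (\sum_r _) => A B; lra.
Qed.

Lemma hderiv0E f p : D p -> hderiv0 k T f p = form_spray G (dform f) p.
Proof.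
move=> Dp.
exact: (@hderiv0_sums _ _ (fun r => p.2 0 r) (G^~ p) (fun r => ddx r f p)
  (fun s => ddy s f p) (fun s r => nonlin_conn k T s r p) (fun s => spray_euler s Dp)).
Qed.

(** Connects the left-hand side of the stated equation with the Euler-Lagrange expression: Euler's
    identity for G^s and for N^s_r removes the connection. *)
Lemma hderiv_eulerE f i p : D p -> Cinf dir D f ->
  hderiv k T i f p - \sum_r ddy i (hderiv k T r f) p * p.2 0 r =
  form_euler G (dform f) i p.
Proof.
move=> Dp fC.
have d r : ddy i (hderiv k T r f) p = ddy i (ddx r f) p -
    \sum_s (nonlin_conn k T s r p * ddy i (ddy s f) p +
       ddy s f p * ddy i (nonlin_conn k T s r) p).
  suff [_ E] : is_derive p (0, basis_vec R i) (hderiv k T r f) (ddy i (ddx r f) p -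
    \sum_s (nonlin_conn k T s r p * ddy i (ddy s f) p +
       ddy s f p * ddy i (nonlin_conn k T s r) p)) by [].
  apply: is_derive_funB.
    exact/derivableP/(Cinf_derivable (Cinf_dform (inl r) fC)).
  apply: is_derive_fun_sum => s _; apply: is_derive_funM.
    exact/derivableP/(Cinf_derivable (Cinf_nonlin_conn s r)).
  exact/derivableP/(Cinf_derivable (Cinf_dform (inr s) fC)).
have E : \sum_r ddy i (hderiv k T r f) p * p.2 0 r = \sum_r (ddy i (ddx r f) p -
    \sum_s (nonlin_conn k T s r p * ddy i (ddy s f) p +
       ddy s f p * ddy i (nonlin_conn k T s r) p)) * p.2 0 r.
  by apply: eq_bigr => r _; apply: (congr1 (fun u => u * _)); exact: d.
apply: etrans (congr1 (fun u => _ - u) E) _.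
exact: (@hderiv_sums _ _ (ddx i f p) (fun r => p.2 0 r) (G^~ p)
  (fun r => ddy i (ddx r f) p) (fun s => ddy i (ddy s f) p) (fun s => ddy s f p)
  (fun s r => nonlin_conn k T s r p) (fun s r => ddy i (nonlin_conn k T s r) p) i
  (fun s => spray_euler s Dp) (fun s => nonlin_conn_euler s i Dp)).
Qed.

(* The Euler-Lagrange expression of L at a point with velocity p.2 and
   acceleration acc. *)
Definition el_residual (Lg : W -> R) (p : W) (acc : V) (i : 'I_n) : R :=
  \sum_l p.2 0 l * ddx l (ddy i Lg) p + \sum_l acc 0 l * ddy l (ddy i Lg) p - ddx i Lg p.

Lemma spray_residual p (acc : V) : D p ->
  (forall i, acc 0 i + 2 * G i p = 0) <-> (forall i, el_residual L p acc i = 0).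
Proof.
move=> Dp.
pose b i := \sum_(l < n) ddx l (ddy i L) p * p.2 0 l - ddx i L p.
apply: iff_trans (@residual_matrix _ _ (fund_tensor k T p) b (G^~ p) acc (gU Dp) _) _.
  by [].
have rE i : el_residual L p acc i = b i + 2 * \sum_l fund_tensor k T p i l * acc 0 l.
  apply: (@residual_sums _ _ (fun l => p.2 0 l) (fun l => acc 0 l)
    (fun l => fund_tensor k T p i l) (fun l => ddx l (ddy i L) p)
    (fun l => ddy l (ddy i L) p)) => l.
  apply: etrans (Cinf_derive_commute oD (inr l) (inr i) Cinf_Fsq Dp) _.
  apply: etrans _ (esym (congr1 (fun u => 2 * u) (fund_tensorE i l p))).
  by rewrite mulrA mulfV ?mul1r // pnatr_eq0.
by split=> H i; have := H i; rewrite rE.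
Qed.

(** [Lg] need not come from the metric whose spray is [G]: taken with the other metric it compares
    sprays, taken with the same one and [P = 0] it yields E(F^2) = 0. *)
Lemma el_residual_form (Lg : W -> R) (P : R) p i : D p ->
  Cinf dir D Lg -> homogeneous D 2 Lg ->
  el_residual Lg p (\row_l (- (2 * (G l p + P * p.2 0 l)))) i =
  - form_euler G (dform Lg) i p - 2 * P * ddy i Lg p.
Proof.
move=> Dp LC Lh.
have cx l : ddx l (ddy i Lg) p = ddy i (ddx l Lg) p.
  exact: (Cinf_derive_commute oD (inl l) (inr i) LC Dp).
have cy l : ddy l (ddy i Lg) p = ddy i (ddy l Lg) p.
  exact: (Cinf_derive_commute oD (inr l) (inr i) LC Dp).
have hy : \sum_l p.2 0 l * ddy l (ddy i Lg) p = 1%:R * ddy i Lg p.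
  apply: (homogeneous_euler (D := D)) => //; first exact: (Cinf_dform (inr i)).
  exact: homogeneous_ddy.
exact: (@residual_form_sums _ _ (fun l => p.2 0 l) (G^~ p) _ _ _ _ P (ddx i Lg p)
  (ddy i Lg p) cx cy hy).
Qed.

Lemma euler_Fsq i p : D p -> form_euler G (dform L) i p = 0.
Proof.
move=> Dp.
have H j : (\row_l (- (2 * (G l p + 0 * p.2 0 l)))) 0 j + 2 * G j p = 0.
  by rewrite mxE mul0r addr0 addNr.
have := (spray_residual _ Dp).1 H i.
rewrite (el_residual_form 0 i Dp Cinf_Fsq homogeneous_Fsq) mulr0 mul0r subr0.
by move=> /eqP; rewrite oppr_eq0 => /eqP.
Qed.

(** Conservation of energy, obtained by contracting E(F^2) = 0 with y^i. *)
Lemma spray_Fsq p : D p -> form_spray G (dform L) p = 0.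
Proof.
move=> Dp; apply: oppr_inj; rewrite oppr0.
rewrite -(euler_contract G oD Dp cone Cinf_Fsq homogeneous_Fsq).
by apply: big1 => i _; rewrite euler_Fsq // mulr0.
Qed.

Lemma spray_form p : D p -> form_spray G (dform T) p = 0.
Proof.
move=> Dp; have := spray_relation G Dp Fsq_relation.
rewrite spray_Fsq // mulr0 => /esym/eqP; rewrite mulf_eq0 => /orP[|/eqP//].
rewrite mulf_eq0 (gt_eqF (Fsq_gt0 Dp)) orbF mulf_eq0 invr_eq0 !pnatr_eq0 /=.
by rewrite eqn0Ngt k0.
Qed.

Lemma euler_form i p : D p -> form_euler G (dform T) i p = 0.
Proof.
move=> Dp; have := euler_relation G oD i Dp TC Cinf_Fsq TC Fsq_relation.
rewrite spray_Fsq // spray_form // euler_Fsq // !mulr0 !subr0.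
move=> /esym/eqP; rewrite mulf_eq0 => /orP[|/eqP//].
rewrite mulf_eq0 (gt_eqF (Fsq_gt0 Dp)) orbF mulf_eq0 invr_eq0 !pnatr_eq0 /=.
by rewrite eqn0Ngt k0.
Qed.

End RootSpray.

(** [t], [A], [l] are the values of T, alpha, \bar F^2; a suffix [i] marks y^i-derivatives; [E], [S]
    are E(alpha)_i and alpha_{;0}, and [EL], [SL] the same for \bar F^2. The hypotheses come from
    \bar T d(\bar F^2) = (2/m) \bar F^2 d\bar T. *)
Lemma projective_algebra {R : realType} (m t A l E S Ti Ai li EL SL : R) :
  m != 0 -> t != 0 -> A != 0 -> l != 0 ->
  A * t * SL = 2 / m * l * (t * S) ->
  A * t * EL - (A * Ti + t * Ai) * SL =
    2 / m * l * (t * E - Ti * S) - 2 / m * li * (t * S) ->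
  A * t * li = 2 / m * l * (A * Ti + t * Ai) ->
  (E = m^-1 * (Ti / t) * S + (1 - m) / m * (Ai / A) * S) <->
  EL + 2 * (SL / (4 * l)) * li = 0.
Proof.
move=> m0 t0 A0 l0 h1 h2 h3.
have At0 : A * t != 0 by rewrite mulf_neq0.
have SLE : SL = 2 / m * l * S / A.
  by apply: (mulfI At0); rewrite h1; field; rewrite A0 m0.
have liE : li = 2 / m * l * (A * Ti + t * Ai) / (A * t).
  by apply: (mulfI At0); rewrite h3; field; rewrite A0 m0 t0.
have ELE : EL = ((A * Ti + t * Ai) * SL +
    (2 / m * l * (t * E - Ti * S) - 2 / m * li * (t * S))) / (A * t).
  by apply: (mulfI At0); rewrite -h2; field; rewrite A0 t0.
(* Multiplied by [A t m / (2 l)], the left side is [t E - Ti S + (1 - 1/m) (A Ti + t Ai) S / A]. The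
   [Ti] terms partly cancel, which explains the unequal coefficients [1/m] and [(1 - m)/m]. *)
have key : EL + 2 * (SL / (4 * l)) * li =
    2 / m * l / A * (E - (m^-1 * (Ti / t) * S + (1 - m) / m * (Ai / A) * S)).
  by rewrite ELE liE SLE; field; rewrite A0 m0 t0 l0.
rewrite key; split=> [->|/eqP]; first by rewrite subrr mulr0.
rewrite mulf_eq0 subr_eq0 => /orP[|/eqP//].
by rewrite !mulf_eq0 !invr_eq0 (negbTE m0) (negbTE l0) (negbTE A0) pnatr_eq0.
Qed.

(** * Comparison of two sprays *)

Section ProjectiveSprays.
Context {R : realType} {n : nat}.
Local Notation V := 'rV[R]_n.
Local Notation W := (V * V)%type.
Variables (k m : nat) (T Tb al : W -> R) (D : set W).
Hypotheses (oD : open D) (k0 : (0 < k)%N) (m0 : (0 < m)%N).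
Hypothesis cone : forall p (l : R), D p -> l != 0 -> D (p.1, l *: p.2).
Hypotheses (TC : Cinf dir D T) (T0 : forall p, D p -> T p != 0).
Hypotheses (Thom : homogeneous D k T).
Hypothesis gU : forall p, D p -> fund_tensor k T p \in unitmx.
Hypotheses (TbC : Cinf dir D Tb) (Tb0 : forall p, D p -> Tb p != 0).
Hypotheses (Tbhom : homogeneous D m Tb).
Hypothesis gbU : forall p, D p -> fund_tensor m Tb p \in unitmx.
Hypothesis TbE : forall p, D p -> Tb p = al p * T p.

Local Notation G := (spray k T).
Local Notation Gb := (spray m Tb).
Local Notation Lb := (Fsq m Tb).

Definition projective_factor p := form_spray G (dform Lb) p / (4 * Lb p).

Lemma Cinf_alpha : Cinf dir D al.
Proof.
apply: (Cinf_eq_on oD (f := fun q => Tb q * (T q)^-1)).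
  by move=> q Dq; rewrite TbE // mulfK // T0.
by apply: CinfM => //; apply: CinfV.
Qed.

Let LbC : Cinf dir D Lb := Cinf_Fsq m oD TbC Tb0.
Let Lbh : homogeneous D 2 Lb := homogeneous_Fsq m0 cone Tb0 Tbhom.

(** The acceleration - 2 (G + P y) is tested in the Euler-Lagrange equations of \bar F^2; they
    determine the acceleration because the fundamental tensor of \bar F is invertible. *)
Lemma spray_shift P p : D p ->
  (forall i, Gb i p = G i p + P * p.2 0 i) <->
  (forall i, form_euler G (dform Lb) i p + 2 * P * ddy i Lb p = 0).
Proof.
move=> Dp.
pose acc : V := \row_l (- (2 * (G l p + P * p.2 0 l))).
have H := spray_residual oD TbC Tb0 gbU acc Dp.
have rE i := el_residual_form k T oD cone P i Dp LbC Lbh.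
have accE i : acc 0 i = - (2 * (G i p + P * p.2 0 i)) by rewrite mxE.
split=> [GE i|fE i].
  have h j : acc 0 j + 2 * Gb j p = 0 by rewrite accE GE addNr.
  have := etrans (esym (rE i)) (H.1 h i).
  move: (form_euler _ _ _ _) (ddy _ _ _) => A B; lra.
have h j : el_residual Lb p acc j = 0.
  apply: etrans (rE j) _; have := fE j.
  move: (form_euler _ _ _ _) (ddy _ _ _) => A B; lra.
move: (accE i) (H.2 h i).
by move: (acc 0 i) (Gb i p) (G i p) (p.2 0 i) => a b c d; lra.
Qed.

(** Contracting the equations of [spray_shift] with y^i leaves - (\bar F^2)_{;0} + 4 P \bar F^2 =
    0. *)
Lemma projective_factor_unique P p : D p ->
  (forall i, Gb i p = G i p + P * p.2 0 i) -> P = projective_factor p.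
Proof.
move=> Dp /(spray_shift P Dp) H.
have E1 := euler_contract G oD Dp cone LbC Lbh.
have E2 := homogeneous_euler LbC Lbh Dp.
have l0 := Fsq_gt0 m Tb0 Dp.
have E3 : \sum_i p.2 0 i * form_euler G (dform Lb) i p = - (2 * P) * (2%:R * Lb p).
  rewrite -E2 mulr_sumr; apply: eq_bigr => i _.
  have := H i; move: (form_euler _ _ _ _) (ddy _ _ _) => A B; nra.
have E4 := oppr_inj (etrans (esym E1) (etrans E3 (mulNr _ _))).
rewrite /projective_factor; apply: (mulIf (x := 4 * Lb p)).
  by rewrite mulf_neq0 ?pnatr_eq0 // gt_eqF.
rewrite divfK; last by rewrite mulf_neq0 ?pnatr_eq0 // gt_eqF.
by apply: etrans _ (esym E4); ring.
Qed.

Lemma alpha_equation_iff p : D p ->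
  (forall i, hderiv k T i al p - \sum_(r < n) ddy i (hderiv k T r al) p * p.2 0 r
       = m%:R^-1 * (ddy i T p / T p) * hderiv0 k T al p
         + (1 - m%:R) / m%:R * (ddy i al p / al p) * hderiv0 k T al p) <->
  (forall i, Gb i p = G i p + projective_factor p * p.2 0 i).
Proof.
move=> Dp; apply: iff_trans _ (iff_sym (spray_shift _ Dp)).
have aC := Cinf_alpha.
have hE i := hderiv_eulerE oD k0 cone TC T0 Thom gU i Dp aC.
have h0E := hderiv0E oD k0 cone TC T0 Thom gU al Dp.
have mn0 : m%:R != 0 :> R by rewrite pnatr_eq0 -lt0n.
(* On the region in question \bar T is nonzero, hence so is alpha. *)
have a0 : al p != 0 by have := Tb0 Dp; rewrite TbE // mulf_eq0 negb_or => /andP[].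
have l0 : Lb p != 0 by rewrite gt_eqF // (Fsq_gt0 m Tb0).
have dE z q : D q -> dform Tb z q = dform (fun q => al q * T q) z q.
  by move=> Dq; apply: (derive_eq_on (D := D)).
(* Since T_{;0} = 0 and E(T) = 0, the Leibniz rules for alpha T lose every term in which an operator
   acts on T. *)
have SE : form_spray G (dform Tb) p = T p * form_spray G (dform al) p.
  have E1 : form_spray G (dform Tb) p = form_spray G (dform (fun q => al q * T q)) p.
    exact (form_spray_eq G Dp dE).
  have E2 := spray_mul G Dp aC TC.
  have aux (A t S S0 : R) : S0 = 0 -> A * S0 + t * S = t * S.
    by move=> ->; rewrite mulr0 add0r.
  have E3 := spray_form oD k0 cone TC T0 Thom gU Dp.
  exact: etrans E1 (etrans E2 (aux _ _ _ _ E3)).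
have EE i : form_euler G (dform Tb) i p =
   T p * form_euler G (dform al) i p - ddy i T p * form_spray G (dform al) p.
  have E1 : form_euler G (dform Tb) i p = form_euler G (dform (fun q => al q * T q)) i p.
    exact (form_euler_eq G oD i Dp dE).
  have E2 := euler_mul G oD i Dp aC TC.
  have aux (A t E S E0 S0 B C : R) : E0 = 0 -> S0 = 0 ->
      A * E0 + t * E - (B * S0 + C * S) = t * E - C * S.
    by move=> -> ->; rewrite !mulr0 !add0r.
  have E3 := euler_form oD k0 cone TC T0 Thom gU i Dp.
  have E4 := spray_form oD k0 cone TC T0 Thom gU Dp.
  exact: etrans E1 (etrans E2 (aux _ _ _ _ _ _ _ _ E3 E4)).
have yE i : ddy i Tb p = al p * ddy i T p + T p * ddy i al p.
  exact: etrans (dE (inr i) p Dp) (ddyM i Dp aC TC).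
have rel := Fsq_relation oD m0 TbC Tb0.
have R1 := spray_relation G Dp rel.
have R2 i := euler_relation G oD i Dp TbC LbC TbC rel.
have R3 i : Tb p * ddy i Lb p = 2 / m%:R * Lb p * ddy i Tb p := rel (inr i) p Dp.
have tE := TbE Dp.
have step i : (form_euler G (dform al) i p =
    m%:R^-1 * (ddy i T p / T p) * form_spray G (dform al) p
         + (1 - m%:R) / m%:R * (ddy i al p / al p) * form_spray G (dform al) p) <->
   form_euler G (dform Lb) i p + 2 * projective_factor p * ddy i Lb p = 0.
  apply: (projective_algebra mn0 (T0 Dp) a0 l0).
  - apply: etrans (congr1 (fun u => u * _) (esym tE)) _.
    exact: etrans R1 (congr1 (fun u => _ * u) SE).
  - apply: etrans (congr2 (fun u v => u * _ - v * _) (esym tE) (esym (yE i))) _.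
    apply: etrans (R2 i) _.
    have cg (a b u u' v v' : R) : u = u' -> v = v' -> a * u - b * v = a * u' - b * v'.
      by move=> -> ->.
    exact (cg _ _ _ _ _ _ (EE i) SE).
  - apply: etrans (congr1 (fun u => u * _) (esym tE)) _.
    exact: etrans (R3 i) (congr1 (fun u => _ * u) (yE i)).
have eqs (e e' s s' a b c d : R) : e = e' -> s = s' ->
    (e = a * b * s + c * d * s) <-> (e' = a * b * s' + c * d * s').
  by move=> -> ->.
split=> H i.
  by apply: (step i).1; apply: (eqs _ _ _ _ _ _ _ _ (hE i) h0E).1; exact: H.
by apply: (eqs _ _ _ _ _ _ _ _ (hE i) h0E).2; apply: (step i).2; exact: H.
Qed.

End ProjectiveSprays.

(** * Changes of coordinates *)

Lemma Cinf_subset {R : realType} {W : normedModType R} {K : Type} (e : K -> W)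
    (D D' : set W) (f : W -> R) : D' `<=` D -> Cinf e D f -> Cinf e D' f.
Proof.
move=> DD fC k; elim: k f fC => [//|k IH] f fC; split=> [q Dq|z].
  by apply: (Cinf_diff fC); exact: DD.
by apply: IH; exact: Cinf_derive.
Qed.

Lemma is_derive_unique {R : realType} {V W : normedModType R} (f : V -> W) (p v : V) a b :
  is_derive p v f a -> is_derive p v f b -> a = b.
Proof. by move=> [_ <-] [_ <-]. Qed.

(** The second derivatives of the coordinate change enter both [A] and [C]; by their symmetry they
    cancel, leaving the transformation law of a covector. *)
Lemma push_sums {R : realType} {n : nat} (A C : R) (J y B X Y : 'I_n -> R)
    (K H : 'I_n -> 'I_n -> R) :
  A = \sum_j (Y j * (\sum_l y l * K l j) + J j * B j) ->
  C = \sum_j J j * X j + \sum_j (\sum_l y l * H l j) * Y j ->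
  (forall l j, K l j = H l j) -> A - C = \sum_j J j * (B j - X j).
Proof.
move=> -> -> KH.
have -> : \sum_j (\sum_l y l * H l j) * Y j = \sum_j Y j * (\sum_l y l * K l j).
  apply: eq_bigr => j _; rewrite mulrC; congr (_ * _); apply: eq_bigr => l _.
  by rewrite KH.
rewrite big_split /= [RHS](eq_bigr (fun j => J j * B j - J j * X j)) => [|j _].
  by rewrite sumrB; ring.
by rewrite mulrBr.
Qed.

Section CoordinateChange.
Context {R : realType} {n : nat}.
Local Notation V := 'rV[R]_n.
Local Notation W := (V * V)%type.
Local Notation e := (@basis_vec R n).
Variables (phi : V -> V) (O : set V).
Hypothesis oO : open O.
Hypothesis phiC : forall j, Cinf e O (fun x => phi x 0 j).

Definition jac (x : V) i j : R := 'D_(e i) (fun x => phi x 0 j) x.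

Definition push_vec (x y : V) : V := \row_j \sum_i y 0 i * jac x i j.

Lemma Cinf_jac i j : Cinf e O (fun x => jac x i j).
Proof. exact: (Cinf_derive i (phiC j)). Qed.

Lemma jac_sym x i l j : O x ->
  'D_(e l) (fun x => jac x i j) x = 'D_(e i) (fun x => jac x l j) x.
Proof. by move=> Ox; exact: (Cinf_derive_commute oO l i (phiC j) Ox). Qed.

Lemma is_derive_phi_comp {U : normedModType R} (x : U -> V) (q v : U) dx :
  O (x q) -> is_derive q v x dx ->
  is_derive q v (fun s => phi (x s)) (push_vec (x q) dx).
Proof.
move=> Ox xd; apply: is_derive_row => j; rewrite mxE.
exact: is_derive_comp_row (Cinf_diff (phiC j) Ox) xd.
Qed.

Lemma derive_phi x y : O x -> 'D_y phi x = push_vec x y.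
Proof.
move=> Ox; have [_ <-] // : is_derive x y phi (push_vec x y).
by apply: is_derive_phi_comp => //; exact: is_derive_id.
Qed.

Lemma is_derive_jac_comp {U : normedModType R} (x : U -> V) (q v : U) dx i j :
  O (x q) -> is_derive q v x dx ->
  is_derive q v (fun s => jac (x s) i j)
    (\sum_l dx 0 l * 'D_(e l) (fun x => jac x i j) (x q)).
Proof.
by move=> Ox xd; apply: is_derive_comp_row (Cinf_diff (Cinf_jac i j) Ox) xd.
Qed.

Lemma is_derive_push {U : normedModType R} (x y : U -> V) (q v : U) dx dy :
  O (x q) -> is_derive q v x dx -> is_derive q v y dy ->
  is_derive q v (fun s => push_vec (x s) (y s))
    (\row_j \sum_i (y q 0 i * (\sum_l dx 0 l * 'D_(e l) (fun x => jac x i j) (x q))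
                    + jac (x q) i j * dy 0 i)).
Proof.
move=> Ox xd yd; apply: is_derive_row => j; rewrite mxE.
have -> : (fun s => push_vec (x s) (y s) 0 j) =
    fun s => \sum_i y s 0 i * jac (x s) i j.
  by apply/funext => s; rewrite mxE.
apply: is_derive_fun_sum => i _; apply: is_derive_funM.
  exact: is_derive_row_coord.
exact: is_derive_jac_comp.
Qed.

Lemma push_basis x i j : push_vec x (e i) 0 j = jac x i j.
Proof. by rewrite mxE (sum_basis (fun i => jac x i j)). Qed.

Lemma push_zero x : push_vec x 0 = 0.
Proof. by apply/rowP => j; rewrite !mxE (sum_zero (fun i => jac x i j)). Qed.

Section Push.
Variables (Lc Ld : W -> R) (Dc Dd : set W).
Hypotheses (oDc : open Dc) (oDd : open Dd).
Hypotheses (LcC : Cinf dir Dc Lc) (LdC : Cinf dir Dd Ld).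
Hypothesis DcO : forall q, Dc q -> O q.1.
Hypothesis push_in : forall q, Dc q -> Dd (phi q.1, push_vec q.1 q.2).
Hypothesis push_eq : forall q, Dc q -> Lc q = Ld (phi q.1, push_vec q.1 q.2).

Local Notation push q := (phi q.1, push_vec q.1 q.2).

Lemma derive_push q (v : W) : Dc q ->
  'D_v Lc q = \sum_j push_vec q.1 v.1 0 j * ddx j Ld (push q)
   + \sum_j (\row_j \sum_i (q.2 0 i * (\sum_l v.1 0 l * 'D_(e l) (fun x => jac x i j) q.1)
                    + jac q.1 i j * v.2 0 i)) 0 j * ddy j Ld (push q).
Proof.
move=> Dq.
have Oq := DcO Dq.
have d1 := is_derive_phi_comp (x := fst) Oq (is_derive_fst q v).
have d2 := is_derive_push (x := fst) Oq (is_derive_fst q v) (is_derive_snd q v).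
have df := Cinf_diff LdC (push_in Dq).
have [_ <-] := is_derive_comp_pair (x := fun q : W => phi q.1)
  (y := fun q : W => push_vec q.1 q.2) df d1 d2.
by apply: (derive_eq_on (D := Dc)).
Qed.

Lemma ddy_push i q : Dc q ->
  ddy i Lc q = \sum_j ddy j Ld (push q) * jac q.1 i j.
Proof.
move=> Dq; apply: etrans (derive_push (0, e i) Dq) _ => /=.
have Z : \sum_j push_vec q.1 0 0 j * ddx j Ld (push q) = 0.
  by apply: big1 => j _; rewrite push_zero mxE mul0r.
apply: etrans (congr1 (fun u => u + _) Z) (etrans (add0r _) _).
apply: eq_bigr => j _; rewrite mxE mulrC; congr (_ * _).
apply: etrans _ (sum_basis (fun l => jac q.1 l j) i).
apply: eq_bigr => l _.
rewrite (sum_zero (fun i => 'D_(e i) (fun x => jac x l j) q.1)) mulr0 add0r.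
exact: mulrC.
Qed.

Lemma ddx_push i q : Dc q ->
  ddx i Lc q = \sum_j jac q.1 i j * ddx j Ld (push q) +
   \sum_j (\sum_l q.2 0 l * 'D_(e i) (fun x => jac x l j) q.1) * ddy j Ld (push q).
Proof.
move=> Dq; apply: etrans (derive_push (e i, 0) Dq) _ => /=.
congr (_ + _); apply: eq_bigr => j _; first by rewrite push_basis.
rewrite mxE; congr (_ * _); apply: eq_bigr => l _.
rewrite (sum_basis (fun k => 'D_(e k) (fun x => jac x l j) q.1)).
by rewrite mxE mulr0 addr0.
Qed.

(** The law for [ddy i Lc] is differentiated along the curve. The new acceleration [acc'] is just
    the derivative of the pushed velocity, so its second-order formula never has to be expanded
    here. *)
Lemma residual_push (x v : R -> V) (t : R) (acc acc' : V) i :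
  (\forall s \near t, Dc (x s, v s)) ->
  is_derive t 1 x (v t) -> is_derive t 1 v acc ->
  is_derive t 1 (fun s => push_vec (x s) (v s)) acc' ->
  el_residual Lc (x t, v t) acc i =
  \sum_j jac (x t) i j * el_residual Ld (phi (x t), push_vec (x t) (v t)) acc' j.
Proof.
move=> nD xd vd vd'.
have Dt : Dc (x t, v t) := nbhs_singleton nD.
have Ot : O (x t) := DcO Dt.
have d1 := is_derive_comp_pair (Cinf_diff (Cinf_dform (inr i) LcC) Dt) xd vd.
have xd' := is_derive_phi_comp Ot xd.
have dd j : is_derive t 1 (fun s => ddy j Ld (phi (x s), push_vec (x s) (v s)))
   (\sum_l (push_vec (x t) (v t)) 0 l * ddx l (ddy j Ld) (phi (x t), push_vec (x t) (v t))
    + \sum_l acc' 0 l * ddy l (ddy j Ld) (phi (x t), push_vec (x t) (v t))).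
  have dj := Cinf_diff (Cinf_dform (inr j) LdC) (push_in Dt).
  exact (is_derive_comp_pair (x := fun s => phi (x s))
    (y := fun s => push_vec (x s) (v s)) dj xd' vd').
have d2 := is_derive_fun_sum (index_enum 'I_n) (P := xpredT)
  (fun j _ => is_derive_funM (dd j) (is_derive_jac_comp i j Ot xd)).
have nE : \near t, \sum_j ddy j Ld (phi (x t), push_vec (x t) (v t)) * jac (x t) i j =
    ddy i Lc (x t, v t).
  by apply: filterS nD => s Ds; exact: esym (ddy_push i Ds).
have d3 := near_eq_is_derive nE d2.
have E := is_derive_unique d1 d3.
exact: (@push_sums _ _ _ _ (fun j => jac (x t) i j) (fun l => v t 0 l) _
  (fun j => ddx j Ld (phi (x t), push_vec (x t) (v t)))
  (fun j => ddy j Ld (phi (x t), push_vec (x t) (v t)))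
  (fun l j => 'D_(e l) (fun x => jac x i j) (x t))
  (fun l j => 'D_(e i) (fun x => jac x l j) (x t)) E (ddx_push i Dt)
  (fun l j => jac_sym i l j Ot)).
Qed.

End Push.

End CoordinateChange.

Section Charts.
Context {R : realType} {n : nat} {M : topologicalType}.
Implicit Types c d : chart R n M.

Lemma chart_img_inv c x : chart_img c x ->
  chart_dom c (chart_inv c x) /\ chart_map c (chart_inv c x) = x.
Proof. by move=> [p cp <-]; rewrite chart_mapK. Qed.

Lemma chart_overlapP c d x :
  chart_overlap c d x <-> chart_img c x /\ chart_dom d (chart_inv c x).
Proof.
split=> [[p [cp dp] <-]|[ix dx]]; first by rewrite chart_mapK //; split=> //; exists p.
by have [cx E] := chart_img_inv ix; exists (chart_inv c x).
Qed.

Lemma open_chart_img c : open (chart_img c).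
Proof. exact: chart_img_open. Qed.

Lemma open_chart_overlap c d : open (chart_overlap c d).
Proof.
rewrite openE => x /chart_overlapP[ix dx].
have n1 : nbhs x (chart_img c) by apply: open_nbhs_nbhs; split=> //; exact: open_chart_img.
have n2 : nbhs x [set z | chart_dom d (chart_inv c z)].
  apply: (chart_inv_cont ix); apply: open_nbhs_nbhs; split=> //.
  exact: chart_dom_open.
by apply: filterS2 n1 n2 => z iz dz; apply/chart_overlapP.
Qed.

Lemma transition_overlap c d x : chart_overlap c d x ->
  chart_overlap d c (transition c d x).
Proof.
move=> [p [cp dp] <-]; exists p; first by split.
by rewrite /transition chart_mapK.
Qed.

Lemma transitionK c d x : chart_overlap c d x ->
  transition d c (transition c d x) = x.
Proof. by move=> [p [cp dp] <-]; rewrite /transition !chart_mapK. Qed.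

Lemma chart_overlap_img c d x : chart_overlap c d x -> chart_img c x.
Proof. by move/chart_overlapP => []. Qed.

End Charts.

Section Tensors.
Context {R : realType} {n : nat} {M : manifold R n}.
Local Notation V := 'rV[R]_n.
Local Notation W := (V * V)%type.
Local Notation e := (@basis_vec R n).
Implicit Types c d : chart_index M.

Definition trans c d := transition (atlas c) (atlas d).

Lemma Cinf_trans c d j : Cinf e (chart_overlap (atlas c) (atlas d))
  (fun x => trans c d x 0 j).
Proof. exact/smooth_on_Cinf/atlas_smooth. Qed.

(** The chain rule for the two transitions, whose composite is the identity near [x]. *)
Lemma push_vecK c d x y : chart_overlap (atlas c) (atlas d) x ->
  push_vec (trans d c) (trans c d x) (push_vec (trans c d) x y) = y.
Proof.
move=> Ox.
have d1 := is_derive_phi_comp (@Cinf_trans c d) Ox (is_derive_id x y).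
have d2 := is_derive_phi_comp (@Cinf_trans d c) (transition_overlap Ox) d1.
apply: (is_derive_unique d2 _).
apply: near_eq_is_derive (is_derive_id x y).
have : nbhs x (chart_overlap (atlas c) (atlas d)).
  by apply: open_nbhs_nbhs; split=> //; exact: open_chart_overlap.
by apply: filterS => z Oz; rewrite /= [RHS]transitionK.
Qed.

Section Forms.
Variables (k : nat) (a : sym_tensor M k).

Lemma root_form_push c d x y : chart_overlap (atlas c) (atlas d) x ->
  root_form a c (x, y) = root_form a d (trans c d x, push_vec (trans c d) x y).
Proof.
move=> Ox; rewrite /root_form /=.
have E J : coef a c x J = \sum_(I : {ffun 'I_k -> 'I_n})
    coef a d (trans c d x) I * \prod_(l < k) jac (trans c d) x (J l) (I l).
  rewrite (coef_compat a J Ox); apply: eq_bigr => I _; congr (_ * _).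
  apply: eq_bigr => l _; rewrite (derive_phi (@Cinf_trans c d) _ Ox).
  exact: push_basis.
transitivity (\sum_(J : {ffun 'I_k -> 'I_n}) \sum_(I : {ffun 'I_k -> 'I_n})
   coef a d (trans c d x) I *
   \prod_(l < k) (y 0 (J l) * jac (trans c d) x (J l) (I l))).
  apply: eq_bigr => J _; rewrite E mulr_suml; apply: eq_bigr => I _.
  by rewrite big_split /= -mulrA; congr (_ * _); rewrite mulrC.
rewrite exchange_big; apply: eq_bigr => I _ /=; rewrite -mulr_sumr; congr (_ * _).
rewrite -(bigA_distr_bigA (fun l i => y 0 i * jac (trans c d) x i (I l))).
by apply: eq_bigr => l _; rewrite mxE.
Qed.

Lemma root_form_scale c (p : W) (l : R) :
  root_form a c (p.1, l *: p.2) = l ^+ k * root_form a c p.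
Proof.
rewrite /root_form /= mulr_sumr; apply: eq_bigr => J _.
rewrite mulrCA; congr (_ * _).
under eq_bigr do rewrite mxE.
by rewrite big_split /= prodr_const card_ord.
Qed.

Lemma open_chart_cyl c : open [set p : W | chart_img (atlas c) p.1].
Proof.
by apply: open_comp => [p _|]; [exact: cvg_fst|exact: open_chart_img].
Qed.

Lemma Cinf_root_form c :
  Cinf dir [set p : W | chart_img (atlas c) p.1] (root_form a c).
Proof.
have oC := @open_chart_cyl c.
apply: Cinf_sum => // J _; apply: CinfM => //.
  have oI : open (chart_img (atlas c)) by exact: open_chart_img.
  by have := Cinf_fst oI (smooth_on_Cinf (coef_smooth a (c := c) J)).
apply: Cinf_prod => // l _; exact: Cinf_snd.
Qed.

Lemma root_regular_neq0 (t : R) : root_regular k t -> t != 0.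
Proof. by rewrite /root_regular; case: ifP => // _ /gt_eqF ->. Qed.

(** For even [k] the factor [l ^+ k] is positive; for odd [k] only nonvanishing is required. So the
    region also admits negative [l]. *)
Lemma root_regularM (l t : R) : l != 0 -> root_regular k t ->
  root_regular k (l ^+ k * t).
Proof.
rewrite /root_regular => l0; case: ifP => [_ t0|/negbT ek t0].
  by rewrite mulf_neq0 // expf_neq0.
by rewrite mulr_gt0 // exprn_even_gt0 // ?l0 ?orbT.
Qed.

Lemma open_root_regular : open [set t : R | root_regular k t].
Proof.
rewrite /root_regular; case: (odd k); first exact: open_neq.
exact: open_gt.
Qed.

Lemma open_regular c : open (regular a c).
Proof.
rewrite openE => p [ip p0 rp].
have n1 : nbhs p [set p : W | chart_img (atlas c) p.1].
  by apply: open_nbhs_nbhs; split=> //; exact: open_chart_cyl.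
have n2 : nbhs p [set p : W | p.2 != 0].
  apply: open_nbhs_nbhs; split=> //.
  apply: (open_comp (f := snd : W -> V) (D := [set y | y != 0])).
    by move=> q _; exact: cvg_snd.
  rewrite (_ : mkset _ = (fun y : V => `|y|) @^-1` [set r : R | 0 < r]).
    apply: open_comp => [y _|]; [exact: norm_continuous|exact: open_gt].
  by apply/seteqP; split=> y /=; rewrite normr_gt0.
have n3 : nbhs p [set p : W | root_regular k (root_form a c p)].
  have cT : {for p, continuous (root_form a c)}.
    exact/differentiable_continuous/(Cinf_diff (Cinf_root_form c) ip).
  apply: (cT [set t | root_regular k t]).
  by apply: open_nbhs_nbhs; split=> //; exact: open_root_regular.
by apply: filterS3 n1 n2 n3 => q *; split.
Qed.

Lemma regular_cone c p (l : R) : regular a c p -> l != 0 ->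
  regular a c (p.1, l *: p.2).
Proof.
move=> [ip p0 rp] l0; split=> //=; first by rewrite scaler_eq0 negb_or l0.
by rewrite root_form_scale; exact: root_regularM.
Qed.

Lemma regular_push c d (p : W) : regular a c p ->
  chart_overlap (atlas c) (atlas d) p.1 ->
  regular a d (trans c d p.1, push_vec (trans c d) p.1 p.2).
Proof.
move=> [ip p0 rp] Op; split=> /=.
- exact: chart_overlap_img (transition_overlap Op).
- apply: contra_neq p0 => E; rewrite -(push_vecK p.2 Op) E.
  by apply: push_zero.
- by rewrite -root_form_push // -surjective_pairing.
Qed.

End Forms.

End Tensors.

(** * Geodesics *)

Section IntegralCurves.
Context {R : realType} {n : nat}.
Local Notation V := 'rV[R]_n.
Local Notation W := (V * V)%type.
Local Notation e := (@basis_vec R n).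
Local Notation K := ('I_n + 'I_n)%type.

Definition point (b : K -> R) : W := (\row_i b (inl i), \row_i b (inr i)).

Definition coords (p : W) (z : K) : R :=
  match z with inl i => p.1 0 i | inr i => p.2 0 i end.

Lemma coordsK p : point (coords p) = p.
Proof.
by rewrite [RHS]surjective_pairing; congr pair; apply/rowP => i; rewrite mxE.
Qed.

Lemma row_norm_le (a : V) (r : R) : 0 <= r -> (forall i, `|a 0 i| <= r) -> `|a| <= r.
Proof.
move=> r0 H; rewrite /Num.Def.normr /= mx_normrE; apply: bigmax_le => // -[i j] _ /=.
by rewrite (ord1 i).
Qed.

Lemma point_norm_le (b : K -> R) (r : R) : 0 <= r ->
  (forall z, `|b z| <= r) -> `|point b| <= r.
Proof.
move=> r0 H.
have h1 : `|\row_i b (inl i)| <= r by apply: row_norm_le => // i; rewrite mxE.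
have h2 : `|\row_i b (inr i)| <= r by apply: row_norm_le => // i; rewrite mxE.
by rewrite -[`|point b|]/(Num.max `|_| `|_|) ge_max h1 h2.
Qed.

(** All partial derivatives are bounded on a ball around [p]; the mean value theorem along the
    segment between two points gives the Lipschitz bound. *)
Lemma lipschitz_near_Cinf (h : K -> W -> R) (D : set W) (p : W) :
  open D -> D p -> (forall k, Cinf dir D (h k)) ->
  exists r Lam, [/\ 0 < r, 0 < Lam &
    lipschitz_near (fun k b => h k (point b)) (coords p) r Lam].
Proof.
move=> oD Dp hC.
pose B := \sum_(y : K * K) `|dform (h y.1) y.2 p| + 1.
have B0 : 0 < B by rewrite ltr_wpDl // sumr_ge0.
have dc (y : K * K) : {for p, continuous (dform (h y.1) y.2)}.
  apply: differentiable_continuous; apply: Cinf_diff Dp.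
  exact: Cinf_dform.
have nB (y : K * K) : \forall q \near p, `|dform (h y.1) y.2 q| <= B.
  have H : \forall q \near p, `|dform (h y.1) y.2 p - dform (h y.1) y.2 q| <= 1.
    by move: (dc y) => /cvgrPdist_le; apply.
  apply: filterS H => q.
  have : `|dform (h y.1) y.2 p| + 1 <= B.
    by rewrite lerD2r (bigD1 y) //= lerDl sumr_ge0.
  move: (dform _ _ q) (dform _ _ p) => A C H1 H2.
  rewrite -[A](subKr C) (le_trans (ler_normB _ _)) // (le_trans _ H1) //.
  by rewrite lerD2l.
have nBall : \forall q \near p, forall y : K * K, `|dform (h y.1) y.2 q| <= B.
  exact: (@filter_forall W _ _ (nbhs p) _ nB).
have nD : nbhs p D by exact: open_nbhs_nbhs.
have /nbhs_normP[r1 /= r10 r1B] : \forall q \near p,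
    D q /\ forall y : K * K, `|dform (h y.1) y.2 q| <= B.
  by apply: filterS2 nD nBall => q Dq H; split.
pose r := r1 / 2.
have r0 : 0 < r by rewrite divr_gt0.
have rr1 : r < r1 by rewrite /r gtr_pMr // invf_lt1 // ltr1n.
pose Lam := B * (#|{: K}|)%:R + 1.
exists r, Lam; split=> //; first by rewrite ltr_wpDl // mulr_ge0 // ltW.
move=> k b c d hb hc hbc.
(* A point of the segment deviates from [p] by a convex combination of two deviations that are at
   most [r] in each coordinate. *)
have inb (s : R) : 0 <= s <= 1 -> `|p - (s *: (point b - point c) + point c)| < r1.
  move=> /andP[s0 s1]; apply: le_lt_trans rr1.
  have -> : p - (s *: (point b - point c) + point c) =
      point (fun z => (1 - s) * (coords p z - c z) + s * (coords p z - b z)).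
    rewrite -{1}(coordsK p) /point.
    by congr pair; apply/rowP => i; rewrite !mxE /=; ring.
  apply: point_norm_le => [|z]; first exact: ltW.
  rewrite (le_trans (ler_normD _ _)) // !normrM (ger0_norm s0).
  have s1' : 0 <= 1 - s by rewrite subr_ge0.
  rewrite (ger0_norm s1') (distrC _ (c z)) (distrC _ (b z)).
  have := hb z; have := hc z; nra.
pose g (s : R) := h k (s *: (point b - point c) + point c).
pose dg (s : R) := \sum_(z : K) (b z - c z) * dform (h k) z (s *: (point b - point c) + point c).
have gd (s : R) : 0 <= s <= 1 -> is_derive s 1 g (dg s).
  move=> s01; have [Dq _] := r1B _ (inb s s01).
  have hd := Cinf_diff (hC k) Dq.
  apply: is_derive_line.
  have -> : dg s = 'd (h k) (s *: (point b - point c) + point c) (point b - point c).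
    rewrite [X in 'd _ _ X](surjective_pairing (point b - point c)) diff_pairE //.
    rewrite /dg big_sumType /=; congr (_ + _); apply: eq_bigr => i _;
      by congr (_ * _); rewrite !mxE.
  by rewrite -deriveE //; apply/derivableP/diff_derivable.
have [s s01] := mean_value ler01 gd.
rewrite /g scale1r scale0r add0r subrK subr0 mulr1 => ->.
have [_ dB] := r1B _ (inb s s01).
rewrite /dg (le_trans (ler_norm_sum _ _ _)) //.
have [z0|K0] := pselect (exists z : K, True); last first.
  rewrite big1 => [|z _]; last by case: K0; exists z.
  case: k {g dg gd s s01 dB} => i; first by case: K0; exists (inl i).
  by case: K0; exists (inl i).
have d0 : 0 <= d by case: z0 => z _; apply: le_trans (hbc z).
apply: (@le_trans _ _ (\sum_(z : K) d * B)).
  by apply: ler_sum => z _; rewrite normrM ler_pM // (dB (k, z)).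
rewrite sumr_const -mulr_natr /Lam mulrDl mul1r.
have -> : d * B * #|{: K}|%:R = B * #|{: K}|%:R * d by ring.
by rewrite lerDl.
Qed.

(** The geodesic equation as a first-order system in (x, y); the interval is finally shrunk so that
    the solution stays in [D]. *)
Lemma integral_curve (G : 'I_n -> W -> R) (D : set W) (p : W) :
  open D -> D p -> (forall i, Cinf dir D (G i)) ->
  exists (x v : R -> V) (eps : R), [/\ 0 < eps, (x 0, v 0) = p &
    forall t : R, `|t| < eps -> [/\ D (x t, v t), is_derive t 1 x (v t) &
      is_derive t 1 v (\row_i (- (2 * G i (x t, v t))))]].
Proof.
move=> oD Dp GC.
pose h (k : K) (q : W) : R :=
  match k with inl i => q.2 0 i | inr i => - (2 * G i q) end.
have hC k : Cinf dir D (h k).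
  case: k => i; first exact: Cinf_snd.
  by apply: CinfN => //; apply: CinfM => //; exact: Cinf_cst.
have [r [Lam [r0 L0 hL]]] := lipschitz_near_Cinf oD Dp hC.
have [u [eps [e0 u0 ud]]] := picard r0 L0 hL.
pose x t : V := \row_i u (inl i) t; pose v t : V := \row_i u (inr i) t.
have E t : point (u^~ t) = (x t, v t) by [].
have xd (t : R) : `|t| < eps -> is_derive t 1 x (v t).
  move=> te; apply: is_derive_row => i; rewrite mxE.
  have := ud (inl i) t te; rewrite /= mxE.
  suff -> : (fun q => x q 0 i) = u (inl i) by [].
  by apply/funext => s; rewrite mxE.
have vd (t : R) : `|t| < eps -> is_derive t 1 v (\row_i (- (2 * G i (x t, v t)))).
  move=> te; apply: is_derive_row => i; rewrite mxE.
  have := ud (inr i) t te; rewrite /= E.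
  suff -> : (fun q => v q 0 i) = u (inr i) by [].
  by apply/funext => s; rewrite mxE.
have p0 : (x 0, v 0) = p.
  rewrite -(coordsK p) /point; congr pair; apply/rowP => i; rewrite !mxE;
    exact: u0.
have z0 : `|0 : R| < eps by rewrite normr0.
have cp : {for 0, continuous (fun t : R => (x t, v t))}.
  apply/differentiable_continuous/derivable1_diffP.
  by have [] := is_derive_pair (xd 0 z0) (vd 0 z0).
have /nbhs_normP[dl /= dl0 H] : \forall t \near (0 : R), D (x t, v t).
  by apply: (cp D); rewrite p0; exact: open_nbhs_nbhs.
exists x, v, (Order.min eps dl); split=> //; first by rewrite lt_min e0.
move=> t; rewrite lt_min => /andP[te td]; split; [|exact: xd|exact: vd].
by apply: H; rewrite /= sub0r normrN.
Qed.

End IntegralCurves.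

Section Curves.
Context {R : realType} {n : nat}.
Local Notation V := 'rV[R]_n.

Lemma near_nbhs (t : R) (P : R -> Prop) :
  (\forall s \near t, P s) -> \forall s \near t, \forall r \near s, P r.
Proof. exact: nbhs_interior. Qed.

Lemma derive1_near (x x' v : R -> V) (t : R) (acc : V) :
  (\forall s \near t, x' s = x s) ->
  (\forall s \near t, is_derive (s : R) 1 x' (v s)) -> is_derive t 1 v acc ->
  [/\ derivable x t 1, derive1 x t = v t & is_derive t 1 (derive1 x) acc].
Proof.
move=> xx xd vd.
have nd : \forall s \near t, is_derive (s : R) 1 x (v s).
  apply: filterS2 (near_nbhs xx) xd => s xs ds.
  exact: near_eq_is_derive xs ds.
have d1E : \forall s \near t, v s = derive1 x s.
  by apply: filterS nd => s [_ E]; rewrite derive1E.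
split.
- by have [] := nbhs_singleton nd.
- exact: esym (nbhs_singleton d1E).
- exact: near_eq_is_derive d1E vd.
Qed.

Lemma is_derive_curve_comp (x : R -> V) (g : R -> R) (s : R) (dx : V) (dg : R) :
  is_derive (g s) 1 x dx -> is_derive s 1 g dg ->
  is_derive s 1 (fun r => x (g r)) (dg *: dx).
Proof.
move=> xd gd; apply: is_derive_row => i; rewrite mxE mulrC.
exact: is_derive1_comp (is_derive_row_coord i xd) gd.
Qed.

Lemma is_derive_curve_scale (x : R -> V) (f : R -> R) (s : R) (dx : V) (df : R) :
  is_derive s 1 x dx -> is_derive s 1 f df ->
  is_derive s 1 (fun r => f r *: x r) (f s *: dx + df *: x s).
Proof.
move=> xd fd; apply: is_derive_row => i; rewrite !mxE (mulrC df).
have -> : (fun q => (f q *: x q) 0 i) = fun q => f q * x q 0 i.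
  by apply/funext => q; rewrite mxE.
exact: is_derive_funM fd (is_derive_row_coord i xd).
Qed.

End Curves.

Section MetricFacts.
Context {R : realType} {n : nat} {M : manifold R n}.
Local Notation V := 'rV[R]_n.
Local Notation W := (V * V)%type.
Variables (k : nat) (a : sym_tensor M k).
Hypothesis metric_a : root_metric a.
Implicit Types c d : chart_index M.

Lemma root_order_gt0 : (0 < k)%N.
Proof. by case: metric_a => /ltnW. Qed.

Lemma fund_tensor_unit c p : regular a c p -> fund_tensor k (root_form a c) p \in unitmx.
Proof. by case: metric_a => _; apply. Qed.

Lemma Cinf_root_form_regular c : Cinf dir (regular a c) (root_form a c).
Proof. by apply: Cinf_subset (Cinf_root_form a c) => p []. Qed.

Lemma root_form_regular_neq0 c p : regular a c p -> root_form a c p != 0.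
Proof. by case=> _ _; exact: root_regular_neq0. Qed.

Lemma homogeneous_root_form (D : set W) c : homogeneous D k (root_form a c).
Proof. by move=> p l _ _; exact: root_form_scale. Qed.

Lemma Fsq_push c d x y : chart_overlap (atlas c) (atlas d) x ->
  Fsq k (root_form a c) (x, y) =
  Fsq k (root_form a d) (trans c d x, push_vec (trans c d) x y).
Proof. by move=> Ox; rewrite /Fsq (root_form_push a y Ox). Qed.

(** The geodesic equation passes to another chart through its Euler-Lagrange form, whose residual
    changes by the Jacobian matrix. *)
Lemma spray_push c d (x v : R -> V) (t : R) (acc acc' : V) :
  (\forall s \near t, regular a c (x s, v s) /\ chart_overlap (atlas c) (atlas d) (x s)) ->
  is_derive t 1 x (v t) -> is_derive t 1 v acc ->
  is_derive t 1 (fun s => push_vec (trans c d) (x s) (v s)) acc' ->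
  (forall i, acc 0 i + 2 * spray k (root_form a c) i (x t, v t) = 0) ->
  (forall i, acc' 0 i + 2 * spray k (root_form a d) i
     (trans c d (x t), push_vec (trans c d) (x t) (v t)) = 0).
Proof.
move=> nr xd vd vd' eqc.
have [rt Ot] := nbhs_singleton nr.
have rt' := regular_push rt Ot.
have oc := @open_regular _ _ _ _ a c; have od := @open_regular _ _ _ _ a d.
have TcC := @Cinf_root_form_regular c; have TdC := @Cinf_root_form_regular d.
have Tc0 := @root_form_regular_neq0 c; have Td0 := @root_form_regular_neq0 d.
have rc : forall i, el_residual (Fsq k (root_form a c)) (x t, v t) acc i = 0.
  exact: (spray_residual oc TcC Tc0 (@fund_tensor_unit c) acc rt).1 eqc.
apply: (spray_residual od TdC Td0 (@fund_tensor_unit d) acc' rt').2.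
pose Dc : set W := [set q | regular a c q /\ chart_overlap (atlas c) (atlas d) q.1].
have oDc : open Dc.
  apply: openI => //; apply: open_comp => [q _|]; first exact: cvg_fst.
  exact: open_chart_overlap.
have LcC : Cinf dir Dc (Fsq k (root_form a c)).
  by apply: Cinf_subset (Cinf_Fsq k oc TcC Tc0) => q [].
have LdC : Cinf dir (regular a d) (Fsq k (root_form a d)) := Cinf_Fsq k od TdC Td0.
have DcO q : Dc q -> chart_overlap (atlas c) (atlas d) q.1 by case.
have Pin q : Dc q -> regular a d (trans c d q.1, push_vec (trans c d) q.1 q.2).
  by case=> rq Oq; exact: regular_push.
have Peq q : Dc q -> Fsq k (root_form a c) q =
    Fsq k (root_form a d) (trans c d q.1, push_vec (trans c d) q.1 q.2).
  by case=> _ Oq; rewrite {1}(surjective_pairing q); exact: Fsq_push.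
have oO := @open_chart_overlap _ _ _ (atlas c) (atlas d).
have rp i := residual_push oO (@Cinf_trans _ _ _ c d) oDc LcC LdC DcO Pin Peq i
  nr xd vd vd'.
move=> j.
(* The Jacobian is inverted by testing against the vector whose push is the j-th basis vector. *)
pose y := push_vec (trans d c) (trans c d (x t)) (basis_vec R j).
have yE : push_vec (trans c d) (x t) y = basis_vec R j.
  have := push_vecK (basis_vec R j) (transition_overlap Ot).
  by rewrite /trans transitionK.
have sumE : \sum_i y 0 i * (\sum_l jac (trans c d) (x t) i l *
    el_residual (Fsq k (root_form a d))
      (trans c d (x t), push_vec (trans c d) (x t) (v t)) acc' l) = 0.
  apply: big1 => i _; rewrite -[X in _ * X](etrans (esym (rc i)) (rp i)).
  by rewrite mulr0.
move: sumE; set r := el_residual _ _ _; move: r => r sumE.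
rewrite -sumE; apply/esym.
transitivity (\sum_l (push_vec (trans c d) (x t) y) 0 l * r l); last first.
  by rewrite yE (sum_basis r).
under eq_bigr do rewrite mulr_sumr.
rewrite exchange_big; apply: eq_bigr => l _ /=.
rewrite mxE mulr_suml; apply: eq_bigr => i _; exact: mulrA.
Qed.

End MetricFacts.

Section Geodesics.
Context {R : realType} {n : nat} {M : manifold R n}.
Local Notation V := 'rV[R]_n.
Local Notation W := (V * V)%type.
Implicit Types c d : chart_index M.

Lemma near_in_chart c (J : set R) (gamma : R -> M) (t : R) :
  open J -> J t -> {for t, continuous gamma} -> chart_dom (atlas c) (gamma t) ->
  \forall s \near t, J s /\ chart_dom (atlas c) (gamma s).
Proof.
move=> oJ Jt gc gt.
have n1 : nbhs t J by exact: open_nbhs_nbhs.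
have n2 : nbhs t (gamma @^-1` chart_dom (atlas c)).
  by apply: gc; apply: open_nbhs_nbhs; split=> //; exact: chart_dom_open.
by apply: filterS2 n1 n2 => s.
Qed.

Section InChart.
Variables (k : nat) (a : sym_tensor M k) (D : chart_index M -> set W).
Variables (J : set R) (gamma : R -> M).
Hypothesis geo : geodesic a D J gamma.

Lemma geodesic_open : open J. Proof. by case: geo. Qed.

Lemma geodesic_continuous t : J t -> {for t, continuous gamma}.
Proof. by case: geo => _ _ _ + Jt => /(_ t Jt)[]. Qed.

Definition coord c (t : R) : V := chart_map (atlas c) (gamma t).

Lemma geodesic_coord c t : J t -> chart_dom (atlas c) (gamma t) ->
  [/\ is_derive t 1 (coord c) (derive1 (coord c) t),
      is_derive t 1 (derive1 (coord c))
        (\row_i (- (2 * spray k (root_form a c) i (coord c t, derive1 (coord c) t)))) &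
      D c (coord c t, derive1 (coord c) t)].
Proof.
move=> Jt ct; case: geo => _ _ _ /(_ t Jt)[_ /(_ c ct)[d1 d2 Dt E]].
split; last exact: Dt.
  by split; [exact: d1|rewrite derive1E].
split; first exact: d2.
rewrite -derive1E; apply/rowP => i; rewrite mxE.
by apply/eqP; rewrite -addr_eq0; apply/eqP; exact: E.
Qed.

Lemma geodesic_coord_push c d t : J t ->
  chart_dom (atlas c) (gamma t) -> chart_dom (atlas d) (gamma t) ->
  chart_overlap (atlas c) (atlas d) (coord c t) /\
  (coord d t, derive1 (coord d) t) =
   (trans c d (coord c t), push_vec (trans c d) (coord c t) (derive1 (coord c) t)).
Proof.
move=> Jt ct dt.
have Ot : chart_overlap (atlas c) (atlas d) (coord c t) by exists (gamma t).
have tE s : chart_dom (atlas c) (gamma s) -> trans c d (coord c s) = coord d s.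
  by move=> cs; rewrite /trans /transition /coord chart_mapK.
split=> //; congr pair; first by rewrite tE.
have [xc _ _] := geodesic_coord Jt ct; have [xd _ _] := geodesic_coord Jt dt.
have d1 := is_derive_phi_comp (@Cinf_trans _ _ _ c d) Ot xc.
apply: is_derive_unique xd _.
apply: near_eq_is_derive d1.
apply: filterS (near_in_chart geodesic_open Jt (geodesic_continuous Jt) ct) => s [_ cs].
exact: tE.
Qed.

End InChart.

(** The curve is built in the single chart [c], whereas a geodesic must satisfy its equation in
    every chart it meets; [spray_push] bridges the gap. *)
Lemma geodesic_of_curve (k : nat) (a : sym_tensor M k) (D : chart_index M -> set W)
    c (x v : R -> V) (eps : R) :
  root_metric a -> (forall d, D d `<=` regular a d) ->
  (forall c d p, D c p -> chart_overlap (atlas c) (atlas d) p.1 ->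
     D d (trans c d p.1, push_vec (trans c d) p.1 p.2)) ->
  0 < eps ->
  (forall t : R, `|t| < eps -> [/\ D c (x t, v t), is_derive t 1 x (v t) &
      is_derive t 1 v (\row_i (- (2 * spray k (root_form a c) i (x t, v t))))]) ->
  geodesic a D [set t | - eps < t < eps] (fun t => chart_inv (atlas c) (x t)).
Proof.
move=> ma Dr Dpush e0 H.
have H' (t : R) : - eps < t < eps -> [/\ D c (x t, v t), is_derive t 1 x (v t) &
      is_derive t 1 v (\row_i (- (2 * spray k (root_form a c) i (x t, v t))))].
  by rewrite -ltr_norml; exact: H.
have xc (t : R) : - eps < t < eps -> {for t, continuous x}.
  move=> te; apply/differentiable_continuous/derivable1_diffP.
  by have [_ []] := H' t te.
have xi (t : R) : - eps < t < eps -> chart_img (atlas c) (x t).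
  by move=> te; have [/Dr[]] := H' t te.
have oJ := @open_symmetric_interval R eps.
split=> //; first exact: is_interval_symmetric.
  by exists 0; rewrite /= oppr_lt0 e0.
move=> t te; have gc : {for t, continuous (fun t => chart_inv (atlas c) (x t))}.
  apply: continuous_comp; first exact: xc.
  exact: (chart_inv_cont (xi t te)).
split=> // d dt.
have nJ : \forall s \near t, - eps < s < eps.
  by apply: (open_nbhs_nbhs (A := [set t | - eps < t < eps])).
have nO : \forall s \near t, chart_overlap (atlas c) (atlas d) (x s).
  apply: (xc t te); apply: open_nbhs_nbhs; split; first exact: open_chart_overlap.
  by apply/chart_overlapP; split=> //; exact: xi.
pose x' s := trans c d (x s).
pose v' s := push_vec (trans c d) (x s) (v s).
have [Dt xd vd] := H' t te.
have Ot := nbhs_singleton nO.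
have vd' := is_derive_push (@Cinf_trans _ _ _ c d) Ot xd vd.
have xd' : \forall s \near t, is_derive (s : R) 1 x' (v' s).
  apply: filterS2 nJ nO => s se Os; have [_ xds _] := H' s se.
  exact (is_derive_phi_comp (@Cinf_trans _ _ _ c d) Os xds).
have xx : \forall s \near t, x' s = (chart_map (atlas d) \o
    (fun t => chart_inv (atlas c) (x t))) s.
  by apply: filterS nJ.
have [E1 E2 [E3 E4]] := derive1_near xx xd' vd'.
move=> X; split; [exact: E1|exact: E3| |].
  rewrite /X E2; have := Dpush c d (x t, v t) Dt Ot; exact.
move=> i; rewrite /X E2 derive1E E4.
have nr : \forall s \near t, regular a c (x s, v s) /\ chart_overlap (atlas c) (atlas d) (x s).
  by apply: filterS2 nJ nO => s se Os; have [/Dr] := H' s se.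
have eqc j : (\row_i (- (2 * spray k (root_form a c) i (x t, v t)))) 0 j +
    2 * spray k (root_form a c) j (x t, v t) = 0 by rewrite mxE addNr.
exact: (spray_push ma nr xd vd vd' eqc i).
Qed.

End Geodesics.

(** The chain rule for the square root, rewritten with P = L_{;0} / (4 L). *)
Lemma speed_sums {R : realType} {n : nat} (y g X Y : 'I_n -> R) (L : R) : 0 < L ->
  (2 * Num.sqrt L)^-1 *
    (\sum_i y i * X i + \sum_i (\row_i (- (2 * g i))) 0 i * Y i) =
  2 * ((\sum_i y i * X i - 2 * \sum_i g i * Y i) / (4 * L)) * Num.sqrt L.
Proof.
move=> L0.
have -> : \sum_i (\row_i (- (2 * g i))) 0 i * Y i = - 2 * \sum_i g i * Y i.
  by rewrite mulr_sumr; apply: eq_bigr => i _; rewrite mxE; ring.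
have s0 : Num.sqrt L != 0 by rewrite gt_eqF // sqrtr_gt0.
have {2}-> : L = Num.sqrt L * Num.sqrt L by rewrite -expr2 sqr_sqrtr // ltW.
move: (Num.sqrt L) s0 (\sum_i _) (\sum_i _) => s s0 A B.
by field.
Qed.

(** * Reparametrization by arclength *)

Section CommonRegion.
Context {R : realType} {n : nat} {M : manifold R n}.
Local Notation V := 'rV[R]_n.
Local Notation W := (V * V)%type.
Variables (k l : nat) (a : sym_tensor M k) (b : sym_tensor M l).
Hypotheses (ma : root_metric a) (mb : root_metric b).
Implicit Types c d : chart_index M.

Local Notation D := (common_regular a b).

Lemma open_common c : open (D c).
Proof. by apply: openI; exact: open_regular. Qed.

Lemma common_cone c p (r : R) : D c p -> r != 0 -> D c (p.1, r *: p.2).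
Proof. by move=> [pa pb] r0; split; exact: regular_cone. Qed.

Lemma common_push c d p : D c p -> chart_overlap (atlas c) (atlas d) p.1 ->
  D d (trans c d p.1, push_vec (trans c d) p.1 p.2).
Proof. by move=> [pa pb] Op; split; exact: regular_push. Qed.

Lemma Cinf_root_form_l c : Cinf dir (D c) (root_form a c).
Proof. by apply: Cinf_subset (@Cinf_root_form_regular _ _ _ _ a c) => p []. Qed.

Lemma Cinf_root_form_r c : Cinf dir (D c) (root_form b c).
Proof. by apply: Cinf_subset (@Cinf_root_form_regular _ _ _ _ b c) => p []. Qed.

Lemma root_form_neq0_l c p : D c p -> root_form a c p != 0.
Proof. by case=> pa _; exact: root_form_regular_neq0. Qed.

Lemma root_form_neq0_r c p : D c p -> root_form b c p != 0.
Proof. by case=> _ pb; exact: root_form_regular_neq0. Qed.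

Lemma fund_tensor_unit_l c p : D c p -> fund_tensor k (root_form a c) p \in unitmx.
Proof. by case=> pa _; exact: fund_tensor_unit. Qed.

Lemma fund_tensor_unit_r c p : D c p -> fund_tensor l (root_form b c) p \in unitmx.
Proof. by case=> _ pb; exact: fund_tensor_unit. Qed.

Lemma Cinf_spray_l c i : Cinf dir (D c) (spray k (root_form a c) i).
Proof.
exact: (Cinf_spray (@open_common c) (@Cinf_root_form_l c) (@root_form_neq0_l c)
  (@fund_tensor_unit_l c) i).
Qed.

Lemma homogeneous_spray_r c i : homogeneous (D c) 2 (spray l (root_form b c) i).
Proof.
exact: (homogeneous_spray (@open_common c) (root_order_gt0 mb) (@common_cone c)
  (@Cinf_root_form_r c) (@root_form_neq0_r c) (@homogeneous_root_form _ _ _ _ b _ c) i).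
Qed.

Definition conformal_factor c p := projective_factor k l (root_form a c) (root_form b c) p.

Lemma conformal_factor_unique c p P : D c p ->
  (forall i, spray l (root_form b c) i p = spray k (root_form a c) i p + P * p.2 0 i) ->
  P = conformal_factor c p.
Proof.
exact: (projective_factor_unique (@open_common c) (root_order_gt0 mb) (@common_cone c)
  (@Cinf_root_form_r c) (@root_form_neq0_r c) (@homogeneous_root_form _ _ _ _ b _ c)
  (@fund_tensor_unit_r c)).
Qed.

Lemma speed_derive c (x v : R -> V) (t : R) : D c (x t, v t) ->
  is_derive t 1 x (v t) ->
  is_derive t 1 v (\row_i (- (2 * spray k (root_form a c) i (x t, v t)))) ->
  is_derive t 1 (fun s => Num.sqrt (Fsq l (root_form b c) (x s, v s)))
    (2 * conformal_factor c (x t, v t) *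
     Num.sqrt (Fsq l (root_form b c) (x t, v t))).
Proof.
move=> Dt xd vd.
have LC := Cinf_Fsq l (@open_common c) (@Cinf_root_form_r c) (@root_form_neq0_r c).
have L0 : 0 < Fsq l (root_form b c) (x t, v t) := Fsq_gt0 l (@root_form_neq0_r c) Dt.
have d1 := is_derive_comp_pair (Cinf_diff LC Dt) xd vd.
have d2 := is_derive_scalar_comp (f := fun s => Fsq l (root_form b c) (x s, v s))
  (is_derive1_sqrt L0) d1.
have E := @speed_sums _ _ (fun i => v t 0 i) (fun i => spray k (root_form a c) i (x t, v t))
  (fun i => ddx i (Fsq l (root_form b c)) (x t, v t))
  (fun i => ddy i (Fsq l (root_form b c)) (x t, v t)) _ L0.
exact (is_derive_eq d2 E).
Qed.

Lemma reparametrized_geodesic (J : set R) (gamma : R -> M) :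
  (forall c p, D c p -> exists P, forall i,
     spray l (root_form b c) i p = spray k (root_form a c) i p + P * p.2 0 i) ->
  geodesic a D J gamma ->
  exists (J' : set R) (gamma' : R -> M),
    geodesic b D J' gamma' /\ gamma @` J = gamma' @` J'.
Proof.
move=> HP geo.
have [oJ iJ J0 _] := geo.
(* An arbitrary chart is chosen at each time to define the speed; as the speed is independent of the
   chart, the choice does not spoil differentiability. *)
have /choice[ct ctP] : forall t, exists c, chart_dom (atlas c) (gamma t).
  by move=> t; exact: atlas_cover.
pose sp c t := Num.sqrt (Fsq l (root_form b c) (coord gamma c t, derive1 (coord gamma c) t)).
pose f t := sp (ct t) t.
have fE c t : J t -> chart_dom (atlas c) (gamma t) -> f t = sp c t.
  move=> Jt cg; have [Ot E] := geodesic_coord_push geo Jt (ctP t) cg.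
  by rewrite /f /sp E (Fsq_push b _ Ot).
have fd c (t : R) : J t -> chart_dom (atlas c) (gamma t) ->
    is_derive t 1 f (2 * conformal_factor c (coord gamma c t, derive1 (coord gamma c) t) * f t).
  move=> Jt cg; have [xd vd Dt] := geodesic_coord geo Jt cg.
  rewrite [X in _ * X](fE c t Jt cg).
  apply: near_eq_is_derive (speed_derive Dt xd vd).
  apply: filterS (near_in_chart oJ Jt (geodesic_continuous geo Jt) cg) => s [Js cs].
  exact: esym (fE c s Js cs).
have f0 t : J t -> 0 < f t.
  move=> Jt; rewrite /f /sp sqrtr_gt0.
  have [_ _ Dt] := geodesic_coord geo Jt (ctP t).
  exact: (Fsq_gt0 l (@root_form_neq0_r (ct t)) Dt).
have fc t : J t -> {for t, continuous f}.
  move=> Jt; apply/differentiable_continuous/derivable1_diffP.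
  by have [] := fd _ _ Jt (ctP t).
have [t0 Jt0] := J0.
(* [F] is the arclength of the second metric and [g] its inverse, of derivative [1 / f]. *)
have [F [_ Fd]] := primitive oJ iJ Jt0 fc.
have [oJ' iJ' [g gP]] := increasing_inverse oJ iJ J0 Fd f0.
have gJ s : (F @` J) s -> J (g s) /\ F (g s) = s.
  by move=> [t Jt <-]; have [-> _] := gP t Jt.
have gd (s : R) : (F @` J) s -> is_derive s 1 g (f (g s))^-1.
  by move=> [t Jt <-]; have [-> ?] := gP t Jt.
exists (F @` J), (fun s => gamma (g s)); split; last first.
  apply/seteqP; split=> _ [t Jt <-].
    by exists (F t); [exists t|have [->] := gP t Jt].
  by have [Jg _] := gJ t Jt; exists (g t).
split=> //; first by exists (F t0), t0.
move=> s Js; have [Jg Fg] := gJ s Js.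
have gc : {for s, continuous g}.
  apply/differentiable_continuous/derivable1_diffP.
  by have [] := gd s Js.
have ggc : {for s, continuous (fun s => gamma (g s))}.
  apply: continuous_comp; first exact: gc.
  exact (geodesic_continuous geo Jg).
split=> // c cg X.
set t := g s in Jg Fg cg.
have nJ : \forall r \near s, (F @` J) r /\ chart_dom (atlas c) (gamma (g r)).
  by have := near_in_chart (gamma := fun s => gamma (g s)) oJ' Js ggc cg.
pose x := coord gamma c; pose v := derive1 x.
pose w t := (f t)^-1 *: v t.
have xd' : \forall r \near s, is_derive (r : R) 1 (fun r => x (g r)) (w (g r)).
  apply: filterS nJ => r [Jr cr]; have [Jgr _] := gJ r Jr.
  have [xd _ _] := geodesic_coord geo Jgr cr.
  exact: is_derive_curve_comp xd (gd r Jr).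
have [xd vd Dt] := geodesic_coord geo Jg cg.
have fdt := fd c t Jg cg.
have fn0 : f t != 0 by rewrite gt_eqF // f0.
have fVd := is_deriveV fn0 fdt.
have wd := is_derive_curve_scale vd fVd.
have wgd := is_derive_curve_comp wd (gd s Js).
have xx : \forall r \near s, x (g r) = X r by apply: filterS nJ.
have [E1 E2 [E3 E4]] := derive1_near xx xd' wgd.
have EX : X s = x t by [].
split; [exact: E1|exact: E3| |].
  rewrite E2 EX; have := common_cone Dt (invr_neq0 fn0); exact.
move=> i; rewrite E2 EX derive1E E4.
(* Since f' = 2 P f, the new acceleration is [f^-2] times - 2 G - 2 P v; degree 2 homogeneity makes
   this - 2 \bar G at the rescaled velocity [w]. *)
have hs := homogeneous_spray_r i Dt (invr_neq0 fn0).
have hs' : spray l (root_form b c) i (x t, w t) =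
  (f t)^-1 ^+ 2 * spray l (root_form b c) i (x t, v t) := hs.
rewrite hs'.
have [P HPt] := HP c _ Dt.
have PE := conformal_factor_unique Dt HPt.
have HPi : spray l (root_form b c) i (x t, v t) =
  spray k (root_form a c) i (x t, v t) + P * v t 0 i := HPt i.
rewrite HPi PE !mxE.
rewrite -/x -/v -/t.
move: (spray k _ _ _) (conformal_factor _ _) (v t 0 i) (f t) fn0 => S C y r r0.
by rewrite /GRing.scale /=; field.
Qed.

End CommonRegion.

(** * From equal images to projectively equal sprays *)

Section Converse.
Context {R : realType} {n : nat} {M : manifold R n}.
Local Notation V := 'rV[R]_n.
Local Notation W := (V * V)%type.
Variables (k l : nat) (a : sym_tensor M k) (b : sym_tensor M l).
Hypotheses (ma : root_metric a) (mb : root_metric b).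
Implicit Types c d : chart_index M.

Local Notation D := (common_regular a b).

(* Near p the coordinate x^i with p.2^i <> 0 is monotone along the geodesic of F
   through p, so it serves as a parameter: a curve with the same image is a C^2
   reparametrization, however it is traversed. *)
Lemma sprays_projective c p : D c p ->
  (forall (J : set R) (gamma : R -> M), geodesic a D J gamma ->
     exists (J' : set R) (gamma' : R -> M),
       geodesic b D J' gamma' /\ gamma @` J = gamma' @` J') ->
  exists P, forall i,
     spray l (root_form b c) i p = spray k (root_form a c) i p + P * p.2 0 i.
Proof.
move=> Dp rel.
have [x [v [eps0 [e00 xv0 H0]]]] := integral_curve (@open_common _ _ _ _ _ a b c) Dp
  (Cinf_spray_l b ma c).
have [i y0] : exists i, p.2 0 i != 0.
  apply: contrapT => H; case: Dp => -[_ /negP + _] _; apply.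
  apply/eqP/rowP => i; rewrite mxE; apply/eqP.
  by apply: contrapT => /negP Hi; apply: H; exists i.
have v0 : v 0 = p.2 by rewrite -xv0.
have x0 : x 0 = p.1 by rewrite -xv0.
(* Multiplying x^i by the sign of its initial velocity makes it increasing, as [increasing_inverse]
   requires. *)
pose sg : R := Num.sg (p.2 0 i).
have sg0 : sg != 0 by rewrite sgr_eq0.
have z0 : `|0 : R| < eps0 by rewrite normr0.
have vid (t : R) : `|t| < eps0 -> is_derive t 1 (fun s => v s 0 i)
    (- (2 * spray k (root_form a c) i (x t, v t))).
  by move=> te; have [_ _ /(is_derive_row_coord i)] := H0 t te; rewrite mxE.
have xid (t : R) : `|t| < eps0 -> is_derive t 1 (fun s => x s 0 i) (v t 0 i).
  by move=> te; have [_ /(is_derive_row_coord i)] := H0 t te.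
have vic : {for (0 : R), continuous (fun s => v s 0 i)}.
  by apply/differentiable_continuous/derivable1_diffP; have [] := vid 0 z0.
have [eps [e0 ee pos]] : exists eps : R, [/\ 0 < eps, eps <= eps0 &
    forall t, `|t| < eps -> 0 < sg * v t 0 i].
  have : \forall t \near (0 : R), `|v 0 0 i - v t 0 i| < `|p.2 0 i|.
    by move: vic => /cvgrPdist_lt; apply; rewrite normr_gt0.
  move/nbhs_normP => [r /= r0 H]; exists (Order.min eps0 r); split.
  - by rewrite lt_min e00.
  - by rewrite ge_min lexx.
  move=> t; rewrite lt_min => /andP[_ tr].
  have /H : `|0 - t| < r by rewrite sub0r normrN.
  rewrite v0 /sg => hl; have [y1|y1|E] := ltgtP (p.2 0 i) 0.
  - move: hl; rewrite ltr0_sg // (ltr0_norm y1) ltr_norml => /andP[h1 h2]; lra.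
  - move: hl; rewrite gtr0_sg // (gtr0_norm y1) ltr_norml => /andP[h1 h2]; lra.
  - by rewrite E eqxx in y0.
have H (t : R) : `|t| < eps -> [/\ D c (x t, v t), is_derive t 1 x (v t) &
      is_derive t 1 v (\row_i (- (2 * spray k (root_form a c) i (x t, v t))))].
  by move=> te; apply: H0; exact: lt_le_trans te ee.
pose J : set R := [set t | - eps < t < eps].
have Jn t : J t -> `|t| < eps by rewrite /J /= ltr_norml.
have J0 : J 0 by rewrite /J /= oppr_lt0 e0.
pose gamma t := chart_inv (atlas c) (x t).
have Dr d : D d `<=` regular a d by move=> q [].
have Dpush c d q := @common_push _ _ _ _ _ a b c d q.
have geo : geodesic a D J gamma := geodesic_of_curve ma Dr Dpush e0 H.
have [J' [gamma' [geo' im]]] := rel J gamma geo.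
have oJ : open J by exact: open_symmetric_interval.
have iJ : is_interval J by exact: is_interval_symmetric.
have hd (t : R) : J t -> is_derive t 1 (fun s => sg * x s 0 i) (sg * v t 0 i).
  move=> /Jn te; rewrite -[sg * _]addr0 -(mulr0 (x t 0 i)).
  exact: is_derive_funM (is_derive_fun_cst _ _ sg) (xid t (lt_le_trans te ee)).
have [_ _ [g gP]] := increasing_inverse oJ iJ (ex_intro _ 0 J0) hd (fun t Jt => pos t (Jn t Jt)).
have oJ' := geodesic_open geo'.
have xi t : J t -> chart_dom (atlas c) (gamma t) /\ chart_map (atlas c) (gamma t) = x t.
  by move=> /Jn te; have [[[xi _ _] _] _ _] := H t te; exact: chart_img_inv.
pose x' := coord gamma' c; pose v' := derive1 x'.
(* The time at which the first geodesic is where [gamma'] is at [s], read off from the i-th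
   coordinate; its smoothness comes from that of [g] and of x'^i. *)
pose tau s := g (sg * x' s 0 i).
have tauP s : J' s -> [/\ chart_dom (atlas c) (gamma' s), J (tau s), x' s = x (tau s) &
    is_derive (sg * x' s 0 i) 1 g (sg * v (tau s) 0 i)^-1].
  move=> Js; have : (gamma @` J) (gamma' s) by rewrite im; exists s.
  move=> [t Jt E]; have [ct xt] := xi t Jt.
  have Ex : x' s = x t by rewrite /x' /coord -E.
  have [gt dt] := gP t Jt.
  have Et : tau s = t by rewrite /tau Ex.
  by rewrite Et Ex; split=> //; rewrite -E.
have cdom s : J' s -> chart_dom (atlas c) (gamma' s) by move=> /tauP[].
have geoc s (Js : J' s) := geodesic_coord geo' Js (cdom s Js).
(* The derivative of [tau]. As a quotient of velocity components it is itself differentiable, so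
   [tau] is twice differentiable. *)
pose mu s := v' s 0 i / v (tau s) 0 i.
have vn0 t : J t -> v t 0 i != 0.
  move=> /Jn /pos; apply: contraTneq => ->; by rewrite mulr0 ltxx.
have taud (s : R) : J' s -> is_derive s 1 tau (mu s).
  move=> Js; have [xd _ _] := geoc s Js; have [_ Jt _ gd] := tauP s Js.
  have d1 : is_derive s 1 (fun s => sg * x' s 0 i) (sg * v' s 0 i).
    rewrite -[sg * _]addr0 -(mulr0 (x' s 0 i)).
    exact: is_derive_funM (is_derive_fun_cst _ _ sg) (is_derive_row_coord i xd).
  have -> : mu s = (sg * v (tau s) 0 i)^-1 * (sg * v' s 0 i).
    by rewrite /mu; field; rewrite sg0 vn0.
  exact (@is_derive1_comp R g (fun s => sg * x' s 0 i) s _ _ gd d1).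
have v'E s : J' s -> mu s *: v (tau s) = v' s.
  move=> Js; have [xd _ _] := geoc s Js; have [_ Jt _ _] := tauP s Js.
  have [_ xdt _] := H _ (Jn _ Jt).
  apply: esym (is_derive_unique xd _).
  apply: near_eq_is_derive (is_derive_curve_comp xdt (taud s Js)).
  have : nbhs s J' by exact: open_nbhs_nbhs.
  by apply: filterS => r Jr; have [_ _ E _] := tauP r Jr; exact: esym E.
have [s Js Es] : (gamma' @` J') (gamma 0) by rewrite -im; exists 0.
have [cs Jt Ex gd] := tauP s Js.
have tau0 : tau s = 0.
  have [_ xt0] := xi 0 J0.
  by rewrite /tau /x' /coord Es xt0; have [] := gP 0 J0.
have [xd vd Ds] := geoc s Js.
have [_ _ vdt] := H _ (Jn _ Jt).
have d2 := is_derive_curve_comp vdt (taud s Js).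
have vt0 := vn0 _ Jt.
have [dmu mud] : exists dmu, is_derive s 1 mu dmu.
  eexists; exact (is_derive_funM (is_derive_row_coord i vd)
    (is_deriveV vt0 (is_derive_row_coord i d2))).
have d3 := is_derive_curve_scale d2 mud.
have near' : \forall r \near s, mu r *: v (tau r) = v' r.
  have : nbhs s J' by exact: open_nbhs_nbhs.
  by apply: filterS => r; exact: v'E.
have E := is_derive_unique vd (near_eq_is_derive near' d3).
(* A geodesic has nonzero velocity, so [mu s] is nonzero; its sign is free, negative when the image
   is run backwards. *)
have mun0 : mu s != 0.
  case: Ds => -[_ v'0 _] _; apply: contra_neq v'0 => m0 /=.
  by rewrite -/x' -/v' -(v'E s Js) m0 scale0r.
have pE : (x' s, v' s) = (p.1, mu s *: p.2).
  by rewrite Ex -(v'E s Js) tau0 x0 v0.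
have hs j := homogeneous_spray_r (a := a) mb j Dp mun0.
(* Comparing accelerations gives - 2 mu^2 \bar G = - 2 mu^2 G + mu' y, where \bar G at mu y has been
   scaled back to y. *)
exists (- dmu / (2 * mu s ^+ 2)) => j.
have := congr1 (fun w : V => w 0 j) E.
rewrite -/x' -/v' pE tau0 xv0 v0.
rewrite [LHS]mxE hs !mxE.
move: (spray l _ _ _) (spray k _ _ _) (mu s) mun0 (p.2 0 j) => B A r r0 y h.
have r2 : 2 * r ^+ 2 != 0 by rewrite mulf_neq0 ?expf_neq0 ?pnatr_eq0.
apply: (mulfI r2).
have -> : 2 * r ^+ 2 * (A + - dmu / (2 * r ^+ 2) * y) = 2 * r ^+ 2 * A - dmu * y.
  by field; rewrite r0.
have -> : 2 * r ^+ 2 * B = - - (2 * (r ^+ 2 * B)) by ring.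
by rewrite h; ring.
Qed.

End Converse.

Theorem mainTheorem7 (R : realType) (n : nat) (M : manifold R n) (m' m : nat)
    (a : sym_tensor M m') (b : sym_tensor M m) (alpha : TM_function M)
    (metric_F : root_metric a) (metric_Fbar : root_metric b)
    (order_lt : (m' < m)%N)
    (Tbar_eq : forall (c : chart_index M) (x y : 'rV[R]_n),
       chart_img (atlas c) x -> y != 0 -> root_form a c (x, y) != 0 ->
       root_form b c (x, y) = alpha c (x, y) * root_form a c (x, y)) :
  projectively_related a b <->
  (forall (c : chart_index M) (p : 'rV[R]_n * 'rV[R]_n),
     common_regular a b c p ->
     let T := root_form a c in
     let al := alpha c in
     forall i : 'I_n,
       hderiv m' T i al p
         - \sum_(r < n) ddy i (hderiv m' T r al) p * p.2 0 r
       = m%:R^-1 * (ddy i T p / T p) * hderiv0 m' T al p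
         + (1 - m%:R) / m%:R * (ddy i al p / al p) * hderiv0 m' T al p).
Proof.
have TbE c p : common_regular a b c p ->
    root_form b c p = alpha c p * root_form a c p.
  move=> Dp; have := root_form_neq0_l Dp; case: Dp => -[ip p0 _] _.
  by case: p ip p0 => x y /=; exact: Tbar_eq.
have key c p (Dp : common_regular a b c p) := alpha_equation_iff (al := alpha c)
  (@open_common _ _ _ _ _ a b c) (root_order_gt0 metric_F)
  (root_order_gt0 metric_Fbar) (@common_cone _ _ _ _ _ a b c)
  (@Cinf_root_form_l _ _ _ _ _ a b c) (@root_form_neq0_l _ _ _ _ _ a b c)
  (@homogeneous_root_form _ _ _ _ a _ c) (@fund_tensor_unit_l _ _ _ _ _ a b metric_F c)
  (@Cinf_root_form_r _ _ _ _ _ a b c) (@root_form_neq0_r _ _ _ _ _ a b c)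
  (@homogeneous_root_form _ _ _ _ b _ c) (@fund_tensor_unit_r _ _ _ _ _ a b metric_Fbar c)
  (TbE c) Dp.
split=> [[rel _] c p Dp T al|H].
  apply: (key c p Dp).2.
  have [P HP] := sprays_projective metric_F metric_Fbar Dp rel.
  (* The factor found from geodesics at this one point must be [projective_factor], as
     [alpha_equation_iff] demands. *)
  by have PE := conformal_factor_unique metric_Fbar Dp HP; move: HP; rewrite PE.
have HP c p : common_regular a b c p -> exists P, forall i,
    spray m (root_form b c) i p = spray m' (root_form a c) i p + P * p.2 0 i.
  by move=> Dp; eexists; exact: (key c p Dp).1 (H c p Dp).
have D_sym c : common_regular a b c = common_regular b a c by exact: setIC.
split=> J gamma geo; first exact: reparametrized_geodesic HP geo.
have DE : common_regular a b = common_regular b a by apply/funext.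
rewrite DE in geo *.
(* With the metrics exchanged the sprays differ by - P y^i. *)
apply: reparametrized_geodesic geo => // c p; rewrite -DE => Dp.
have [P PE] := HP c p Dp; exists (- P) => i.
by rewrite PE mulNr addrK.
Qed.
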